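(* Let $M>0$ and let $\rho_1,\sigma_1\in H^2(-1,0)$, $q_1\in C([-1,0])$, $\rho_2,\sigma_2\in H^2(0,1)$, $q_2\in C([0,1])$ be real-valued and uniformly positive (each bounded below by a positive constant). Let $0<\nu_1<\nu_2<\cdots$ be the eigenvalues of the spectral problem $$\begin{cases}-(\sigma_1(x)u')'+q_1(x)u=\nu\rho_1(x)u,& x\in(-1,0),\\ -(\sigma_2(x)v')'+q_2(x)v=\nu\rho_2(x)v,& x\in(0,1),\\ u(-1)=v'(1)=0,\quad u(0)=v(0),\\ \sigma_1(0)u'(0)-\sigma_2(0)v'(0)=\nu Mu(0).\end{cases}$$ Then there is a constant $\delta_2>0$ such that $$\nu_{n+1}-\nu_n\ge\delta_2\qquad\text{for all } n\ge1.$$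
   Context: An eigenvalue is a value $\nu$ for which the problem has a nonzero solution $(u,v)$. The eigenvalues of this problem are simple and positive and form an increasing sequence $(\nu_n)_{n\ge1}$ tending to $+\infty$. *)

(* Defs.v *)
From HB Require Import structures.
From mathcomp Require Import all_boot all_order all_algebra.
From mathcomp Require Import all_classical all_reals all_analysis.

Set Implicit Arguments.
Unset Strict Implicit.
Unset Printing Implicit Defensive.
Import Order.TTheory GRing.Theory Num.Theory.
Import numFieldNormedType.Exports.
Local Open Scope ring_scope.
Local Open Scope classical_set_scope.

(* A function on [a, b] is represented by a total function R -> R, whose values
   outside [a, b] are irrelevant.  Test functions, the elements of C^1_c(a, b),
   are instead taken on the whole of R, extended by zero. *)
Definition test_function (R : realType) (a b : R) (phi : R -> R) : Prop :=
  [/\ (forall x : R, derivable phi x 1), continuous phi^`() &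
      exists K : set R, [/\ compact K, K `<=` `]a, b[ &
        forall x : R, ~ K x -> phi x = 0]].

Definition L2 (R : realType) (a b : R) (f : R -> R) : Prop :=
  f \_ `]a, b[ \in Lfun (@lebesgue_measure R) 2%:E.

Definition weak_derivative (R : realType) (a b : R) (f g : R -> R) : Prop :=
  forall phi : R -> R, test_function a b phi ->
    \int[lebesgue_measure]_(x in `]a, b[) (f x * phi^`()%classic x) =
    - \int[lebesgue_measure]_(x in `]a, b[) (g x * phi x).

(* f is the continuous representative, on [a, b], of an element of the Sobolev
   space H^2(a, b); point values such as f a and f b refer to it. *)
Definition H2 (R : realType) (a b : R) (f : R -> R) : Prop :=
  {within `[a, b], continuous f} /\
  exists f' f'' : R -> R,
    [/\ L2 a b f, L2 a b f', L2 a b f'',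
        weak_derivative a b f f' & weak_derivative a b f' f''].

Definition uniformly_positive (R : realType) (a b : R) (f : R -> R) : Prop :=
  exists2 c : R, 0 < c & {in `[a, b], forall x : R, c <= f x}.

(* u is of class C^1 on [a, b] with derivative u', where u' a and u' b are the
   one-sided derivatives of u at the endpoints (by continuity of u'). *)
Definition C1_with_derivative (R : realType) (a b : R) (u u' : R -> R) : Prop :=
  [/\ {within `[a, b], continuous u}, {within `[a, b], continuous u'} &
      {in `]a, b[, forall x : R, is_derive x 1 u (u' x)}].

Definition SL_equation (R : realType) (a b : R) (rho sigma q : R -> R) (nu : R)
    (u u' : R -> R) : Prop :=
  {in `]a, b[, forall x : R,
    derivable (fun y => sigma y * u' y) x 1 /\
    - (fun y => sigma y * u' y)^`()%classic x + q x * u x = nu * rho x * u x}.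

Definition solution (R : realType) (M : R)
    (rho1 sigma1 q1 rho2 sigma2 q2 : R -> R) (nu : R) (u v : R -> R) : Prop :=
  exists u' v' : R -> R,
    [/\ C1_with_derivative (-1) 0 u u' /\ C1_with_derivative 0 1 v v',
        SL_equation (-1) 0 rho1 sigma1 q1 nu u u',
        SL_equation 0 1 rho2 sigma2 q2 nu v v',
        [/\ u (-1) = 0, v' 1 = 0 & u 0 = v 0] &
        sigma1 0 * u' 0 - sigma2 0 * v' 0 = nu * M * u 0].

Definition SL_eigenvalue (R : realType) (M : R)
    (rho1 sigma1 q1 rho2 sigma2 q2 : R -> R) (nu : R) : Prop :=
  exists u v : R -> R,
    solution M rho1 sigma1 q1 rho2 sigma2 q2 nu u v /\
    ((exists2 x : R, x \in `[-1, 0] & u x != 0) \/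
     (exists2 x : R, x \in `[0, 1] & v x != 0)).

(* Main.v *)
Require Import Defs.
From mathcomp Require Import all_boot all_order all_algebra.
From mathcomp Require Import all_classical all_reals all_analysis.
From mathcomp Require Import measurable_realfun ring lra.
Set Implicit Arguments.
Unset Strict Implicit.
Unset Printing Implicit Defensive.
Import Order.TTheory GRing.Theory Num.Theory.
Import numFieldNormedType.Exports.
Local Open Scope ring_scope.
Local Open Scope classical_set_scope.

(** Two eigenvalues [nu] and [nu + d] cannot coexist when [d > 0] lies below a
    threshold that does not depend on [nu >= nu 0]; this is the uniform gap.

    On each side the equation is written as a first-order system for the
    solution [f] and its flux [p = sigma * f'], with [tau = 1 / sigma]:
    [f' = tau * p] and [p' = (q - nu * rho) * f].  The right interval is
    reflected onto [[-1, 0]], so that the two sides play symmetric roles: each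
    starts at [-1] with initial data in a line ([f1 (-1) = 0], resp.
    [p2 (-1) = 0]) and they meet at [0], where [f1 0 = f2 0] and
    [p1 0 + p2 0 = nu * M * f1 0] ([coupled_state]).

    One side.  The energy [tau * p ^ 2 + nu * rho * f ^ 2] has a logarithmic
    derivative bounded independently of [nu], because [rho] and [tau] have
    bounded derivatives and the large terms [nu * rho * tau * f * p] cancel.
    Hence the amplitude [p ^ 2 + nu * f ^ 2] of a solution is comparable at
    all points ([amplitude_comparable]).  Gronwall's inequality applied to the
    energy of the difference of two solutions, for [nu] and [nu + d], with the
    same initial data bounds this difference by [d / sqrt nu] relative to the
    solution itself ([perturbation_bound]).  The derivative of the Wronskian of
    these two solutions is [d * rho * f * w], and a virial identity shows that
    [nu * f ^ 2] carries a fixed share of the energy; so the Wronskian at [0]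
    is at least a constant times [(d / nu) * amplitude] ([wronskian_bound]).

    The interface.  Up to factors [k1] and [k2], the second eigenfunction is
    made of the solutions [w1], [w2] for [nu + d] with the initial data of the
    first.  The conditions at [0] give
    [k1 * W1 + k2 * W2 = - d * M * k1 * f1 0 * w1 0] for the Wronskians at [0].
    If [k1] and [k2] have the same sign, the left-hand side has order [d / nu],
    so [f1] and [w1] have opposite signs at [0]; being close, both are then of
    order [d / nu], and the right-hand side is too small
    ([interface_same_sign]).  If [k1] and [k2] have opposite signs, there is a
    side on which the two solutions do not have the same strict sign at [0].
    There both values are tiny compared with the fluxes, so the jump condition
    transfers the fluxes to the other side with a change of sign; but then on
    the other side the flux, which makes up nearly all of the amplitude,
    changes sign between [nu] and [nu + d], against the perturbation bound
    ([interface_opposite_sign]).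

    Regularity.  The energy estimate asks for derivatives of [rho] and [sigma]
    that are bounded.  For an element of [H^2] they come from testing the
    second weak derivative against smoothed hat functions: the slopes of [f]
    over two adjacent intervals differ by at most the integral of [|f''|] over
    their union, so the difference quotients are bounded and Cauchy
    ([H2_derivable_bounded]). *)

(** * Functions with a prescribed derivative inside an interval *)

(** Nothing is asked at the endpoints beyond continuity; this is what the
    coefficients and the solutions have in common, and it is enough for the
    mean value theorem. *)
Definition antiderivative_on {R : realType} (a b : R) (f df : R -> R) :=
  {within `[a, b], continuous f} /\
  (forall x, a < x < b -> is_derive x 1 f (df x)).

Section Antiderivative.
Context {R : realType}.
Implicit Types (a b x y : R) (f g df dg : R -> R).

Lemma antiderivative_onD a b f df g dg :
  antiderivative_on a b f df -> antiderivative_on a b g dg ->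
  antiderivative_on a b (fun x => f x + g x) (fun x => df x + dg x).
Proof.
move=> [cf f'] [cg g']; split=> [x|x xab].
  by apply: continuousD; [exact: cf|exact: cg].
have := f' x xab; have := g' x xab => ? ?.
exact: is_deriveD.
Qed.

Lemma antiderivative_onN a b f df :
  antiderivative_on a b f df ->
  antiderivative_on a b (fun x => - f x) (fun x => - df x).
Proof.
move=> [cf f']; split=> [x|x xab].
  by apply: continuousN; exact: cf.
have := f' x xab => ?; exact: is_deriveN.
Qed.

Lemma antiderivative_onM a b f df g dg :
  antiderivative_on a b f df -> antiderivative_on a b g dg ->
  antiderivative_on a b (fun x => f x * g x)
    (fun x => df x * g x + f x * dg x).
Proof.
move=> [cf f'] [cg g']; split=> [x|x xab].
  by apply: continuousM; [exact: cf|exact: cg].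
have := f' x xab; have := g' x xab => ? ?.
apply: (is_derive_eq (is_deriveM _ _)).
by rewrite /GRing.scale /= addrC [df x * _]mulrC.
Qed.

Lemma antiderivative_on_cst a b (c : R) :
  antiderivative_on a b (fun=> c) (fun=> 0).
Proof.
split=> [x|x xab]; first exact: cvg_cst.
exact: is_derive_cst.
Qed.

Lemma antiderivative_on_id a b : antiderivative_on a b id (fun=> 1).
Proof.
split=> [|x xab]; last exact: is_derive_id.
by apply: continuous_subspaceT => x; exact: cvg_id.
Qed.

Lemma antiderivative_onZ a b (c : R) f df :
  antiderivative_on a b f df ->
  antiderivative_on a b (fun x => c * f x) (fun x => c * df x).
Proof.
move=> fdf; have := antiderivative_onM (antiderivative_on_cst a b c) fdf.
by congr antiderivative_on; apply/funext => x; rewrite mul0r add0r.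
Qed.

Lemma antiderivative_on_eq a b f df g dg :
  antiderivative_on a b f df -> f = g -> (forall x, a < x < b -> df x = dg x) ->
  antiderivative_on a b g dg.
Proof.
by move=> [cf f'] <- e; split=> // x xab; rewrite -e//; exact: f'.
Qed.

Lemma antiderivative_on_le a b f df : antiderivative_on a b f df ->
  (forall x, a < x < b -> 0 <= df x) ->
  forall x y, a <= x -> x <= y -> y <= b -> f x <= f y.
Proof.
move=> [cf f'] df0 x y ax; rewrite le_eqVlt => /predU1P[->//|xy] yb.
rewrite -subr_ge0.
have xyab : `[x, y] `<=` `[a, b] by apply/subset_itv; rewrite bnd_simp.
have inab z : z \in `]x, y[%R -> a < z < b.
  rewrite in_itv/= => /andP[xz zy].
  by rewrite (le_lt_trans ax)//= (lt_le_trans zy).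
have [z zxy ->] := MVT xy (fun z zxy => f' z (inab z zxy))
  (continuous_subspaceW xyab cf).
by rewrite mulr_ge0 ?df0 ?inab// subr_ge0 ltW.
Qed.

(** Gronwall's inequality, without an integral: [f * expR (- K x)] is
    monotone. *)
Lemma gronwall_le a b f df (K : R) : antiderivative_on a b f df ->
  (forall x, a < x < b -> df x <= K * f x) ->
  forall x y, a <= x -> x <= y -> y <= b -> f y <= expR (K * (y - x)) * f x.
Proof.
move=> fdf dfK x y ax xy yb.
have edf : antiderivative_on a b (fun x => expR (- K * x))
    (fun x => - K * expR (- K * x)).
  split=> [|z _].
    apply: continuous_subspaceT => z.
    by apply: continuous_comp; [exact: mulrl_continuous|exact: continuous_expR].
  have dK : is_derive z 1 (fun x => - K * x) (- K).
    apply: (is_derive_eq (is_deriveZ _ _)).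
    by rewrite /GRing.scale/= mulr1.
  apply: (is_derive_eq (is_derive1_comp _ _)).
  by rewrite mulrC.
have h : expR (- K * y) * f y <= expR (- K * x) * f x.
  rewrite -lerN2; apply: (antiderivative_on_le
    (antiderivative_onN (antiderivative_onM edf fdf)) _ ax xy yb) => z /dfK dz.
  have -> : - (- K * expR (- K * z) * f z + expR (- K * z) * df z) =
            expR (- K * z) * (K * f z - df z) by ring.
  by rewrite mulr_ge0 ?expR_ge0// subr_ge0.
have ->: K * (y - x) = K * y + - K * x by ring.
rewrite expRD -mulrA.
have -> : f y = expR (K * y) * (expR (- K * y) * f y).
  by rewrite mulrA -expRD mulNr subrr expR0 mul1r.
by rewrite ler_wpM2l// expR_ge0.
Qed.

End Antiderivative.

(** * Cubic splines and smoothed hat functions *)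

Section Spline.
Context {R : realType}.
Implicit Types (s x y z e : R).

(** The truncated powers, from which splines of any smoothness are built. *)
Definition pospart_pow (n : nat) (s : R) : R := Num.max s 0 ^+ n.

Lemma is_derive_pospart_pow (n : nat) (s : R) :
  is_derive s 1 (pospart_pow n.+2) (n.+2%:R * pospart_pow n.+1 s).
Proof.
have [s0|s0|->] := ltgtP s 0.
- have -> : n.+2%:R * pospart_pow n.+1 s = 0 :> R.
    by rewrite /pospart_pow max_r ?ltW// expr0n mulr0.
  apply: (@near_eq_is_derive _ _ _ (cst 0)); rewrite ?oner_eq0//.
  near=> t; rewrite /pospart_pow max_r ?expr0n//.
  by near: t; exact: lt_le_nbhsl.
- have -> : n.+2%:R * pospart_pow n.+1 s = n.+2%:R * s ^+ n.+1.
    by rewrite /pospart_pow max_l ?ltW.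
  apply: (@near_eq_is_derive R R R (fun t : R => t ^+ n.+2)); rewrite ?oner_eq0//.
  + near=> t; rewrite /pospart_pow max_l//.
    by apply: ltW; near: t; exact: lt_nbhsr.
  + have -> : (fun t : R => t ^+ n.+2) = (@id R) ^+ n.+2 by rewrite exprfctE.
    by apply: is_derive_eq; rewrite /GRing.scale/= mulr1.
- have -> : n.+2%:R * pospart_pow n.+1 0 = 0 :> R.
    by rewrite /pospart_pow maxxx expr0n mulr0.
  have cv : h^-1 *: (pospart_pow n.+2 (h *: 1 + 0 : R) - pospart_pow n.+2 0)
       @[h --> (0:R)^'] --> (0 : R).
    apply/cvgrPdist_le => e e0; near=> h.
    have h0 : h != 0 by near: h; exact: nbhs_dnbhs_neq.
    have he : `|h| <= e by near: h; exact: dnbhs0_le.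
    have h1 : `|h| <= 1 by near: h; exact: dnbhs0_le.
    have [m0 mh] : 0 <= Num.max h 0 /\ Num.max h 0 <= `|h|.
      by rewrite le_max lexx orbT ge_max ler_norm normr_ge0.
    rewrite sub0r normrN /pospart_pow /GRing.scale/= mulr1 addr0 maxxx expr0n subr0.
    rewrite normrM normfV normrX (ger0_norm m0) mulrC ler_pdivrMr ?normr_gt0//.
    apply: (@le_trans _ _ (`|h| ^+ n.+2)); first by rewrite lerXn2r// nnegrE.
    rewrite exprSr ler_pM// (le_trans _ he)// exprSr ler_piMl//.
    by rewrite exprn_ile1.
  apply: DeriveDef; first by apply/cvg_ex; exists 0.
  exact/cvg_lim.
Unshelve. all: by end_near. Qed.


Lemma is_derive_comp_shift (f : R -> R) (df x s : R) :
  is_derive (s - x) 1 f df -> is_derive s 1 (fun t => f (t - x)) df.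
Proof.
move=> fd; have sh : is_derive s 1 (fun t => t - x) 1.
  apply: (is_derive_eq (is_deriveD _ _)); exact: addr0.
by have := @is_derive1_comp _ _ (fun t => t - x) _ _ _ fd sh; rewrite mulr1.
Qed.

(** The second difference, with step [e], of a truncated power.  [spline 1 e]
    is the tent function on [[0, 2 * e]], normalized so as to have integral
    [1]; [spline 2 e] is its primitive, a smoothed Heaviside function, and
    [spline 3 e] a smoothed positive part, equal to [s - e] beyond [2 * e]. *)
Definition spline (n : nat) (e s : R) : R :=
  (pospart_pow n s - 2 * pospart_pow n (s - e) + pospart_pow n (s - 2 * e))
  / (n`!%:R * e ^+ 2).

Lemma is_derive_spline (n : nat) (e s : R) : e != 0 ->
  is_derive s 1 (spline n.+2 e) (spline n.+1 e s).
Proof.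
move=> e0.
have d0 := is_derive_pospart_pow n s.
have d1 := is_derive_comp_shift (is_derive_pospart_pow n (s - e)).
have d2 := is_derive_comp_shift (is_derive_pospart_pow n (s - 2 * e)).
have -> : spline n.+2 e = fun s => (n.+2`!%:R * e ^+ 2)^-1 *
  (pospart_pow n.+2 s + (- 2) * pospart_pow n.+2 (s - e)
   + pospart_pow n.+2 (s - 2 * e)).
  by apply/funext => t; rewrite /spline mulrC mulNr.
apply: (is_derive_eq (is_deriveZ _
  (is_deriveD (is_deriveD _ (is_deriveZ _ _)) _))).
rewrite /spline /GRing.scale/= [in LHS]factS natrM.
have n0 : n.+1`!%:R != 0 :> R by rewrite pnatr_eq0 -lt0n fact_gt0.
have k0 : n.+2%:R != 0 :> R by rewrite pnatr_eq0.
move: n.+2%:R n.+1`!%:R k0 n0 => k n0 k0 n00.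
by field; rewrite e0 n00 k0.
Qed.

Lemma continuous_spline (n : nat) (e : R) : continuous (spline n.+1 e).
Proof.
have cp (c : R) : continuous (fun s : R => pospart_pow n.+1 (s - c)).
  move=> s; apply: (@continuous_comp _ _ _ (fun t : R => Num.max (t - c) 0)
    (fun y : R => y ^+ n.+1)); last exact: exprn_continuous.
  have cm : (fun t : R => Num.max (t - c) 0) = (fun t => t - c) \max cst 0 by [].
  rewrite cm; apply: continuous_max; last exact: cvg_cst.
  by apply: cvgB; [exact: cvg_id|exact: cvg_cst].
move=> s; apply: cvgMl; apply: cvgD; last exact: cp.
apply: cvgB; first by have := cp 0 s; under eq_fun do rewrite subr0.
by apply: cvgMr; exact: cp.
Qed.

Lemma spline_le0 (n : nat) (e s : R) : 0 < e -> s <= 0 -> spline n.+1 e s = 0.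
Proof.
move=> e0 s0; rewrite /spline /pospart_pow.
by rewrite !max_r ?expr0n ?mulr0 ?addr0 ?subr0 ?mul0r//; lra.
Qed.

Lemma spline_ge (n : nat) (e s : R) : 0 < e -> 2 * e <= s ->
  spline n.+1 e s = (s ^+ n.+1 - 2 * (s - e) ^+ n.+1 + (s - 2 * e) ^+ n.+1)
    / (n.+1`!%:R * e ^+ 2).
Proof. by move=> e0 s0; rewrite /spline /pospart_pow !max_l//; lra. Qed.

Lemma spline1_ge (e s : R) : 0 < e -> 2 * e <= s -> spline 1 e s = 0.
Proof.
move=> e0 s0; rewrite spline_ge// !expr1.
by rewrite (_ : _ + _ = 0) ?mul0r//; ring.
Qed.

Lemma spline2_ge (e s : R) : 0 < e -> 2 * e <= s -> spline 2 e s = 1.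
Proof.
by move=> e0 s0; rewrite spline_ge// !factS fact0; field; rewrite gt_eqF.
Qed.

Lemma spline3_ge (e s : R) : 0 < e -> 2 * e <= s -> spline 3 e s = s - e.
Proof.
by move=> e0 s0; rewrite spline_ge// !factS fact0; field; rewrite gt_eqF.
Qed.

Lemma spline1_ge0 (e s : R) : 0 < e -> 0 <= spline 1 e s.
Proof.
move=> e0; apply: divr_ge0; last first.
  by rewrite mulr_ge0 ?ler0n// sqr_ge0.
rewrite /pospart_pow !expr1.
by case: (leP s 0) => h1; case: (leP (s - e) 0) => h2;
  case: (leP (s - 2 * e) 0) => h3; lra.
Qed.

Lemma spline_antiderivative (n : nat) (e x a b : R) : 0 < e ->
  antiderivative_on a b (fun s => spline n.+2 e (s - x))
    (fun s => spline n.+1 e (s - x)).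
Proof.
move=> e0; have D s := is_derive_comp_shift
  (is_derive_spline n (s - x) (lt0r_neq0 e0)).
split=> [|s _]; last exact: D.
apply: continuous_subspaceT => s.
by apply: differentiable_continuous; apply/derivable1_diffP; have [] := D s.
Qed.

(** [spline 2 e] increases from [0] to [1], as its derivative [spline 1 e] is
    nonnegative. *)
Lemma spline2_itv (e s : R) : 0 < e -> 0 <= spline 2 e s <= 1.
Proof.
move=> e0.
have [s0|s0] := leP s 0; first by rewrite spline_le0// lexx ler01.
have [s1|s1] := leP (2 * e) s; first by rewrite spline2_ge// lexx ler01.
have D := spline_antiderivative 0 0 0 (2 * e) e0.
have {}D := antiderivative_on_le D (fun t _ => spline1_ge0 (t - 0) e0).
have := D 0 s (lexx _) (ltW s0) (ltW s1).
have := D s (2 * e) (ltW s0) (ltW s1) (lexx _).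
rewrite !subr0 (spline2_ge e0 (lexx _)) (spline_le0 1 e0 (lexx 0)).
by move=> -> ->.
Qed.

Lemma spline3_lipschitz (e s t : R) : 0 < e -> s <= t ->
  0 <= spline 3 e t - spline 3 e s <= t - s.
Proof.
move=> e0 st.
have D := spline_antiderivative 1 0 s t e0.
have Did := antiderivative_onD (antiderivative_on_id s t) (antiderivative_onN D).
have := antiderivative_on_le D _ (lexx _) st (lexx _).
have := antiderivative_on_le Did _ (lexx _) st (lexx _).
rewrite !subr0 => h1 h2; rewrite subr_ge0; apply/andP; split.
  by apply: h2 => z _; rewrite subr0; case/andP: (spline2_itv z e0).
suff : s - spline 3 e s <= t - spline 3 e t by lra.
by apply: h1 => z _; rewrite subr0 subr_ge0; case/andP: (spline2_itv z e0).
Qed.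

End Spline.

Section Hat.
Context {R : realType}.
Notation mu := (@lebesgue_measure R).
Variables (e x y z : R).
Hypotheses (e_gt0 : 0 < e) (xy : x < y) (yz : y < z).

(** A second divided difference of splines.  [hat 3] is a smoothed hat function
    with vertices [x], [y], [z], and its second derivative [hat 1] is a
    combination of approximate Dirac masses at these points. *)
Definition hat (n : nat) (s : R) : R :=
  (spline n e (s - x) - spline n e (s - y)) / (y - x) -
  (spline n e (s - y) - spline n e (s - z)) / (z - y).

Lemma is_derive_hat (n : nat) (s : R) :
  is_derive s 1 (hat n.+2) (hat n.+1 s).
Proof.
have D t := is_derive_comp_shift
  (is_derive_spline n (s - t) (lt0r_neq0 e_gt0)).
have Dx := D x; have Dy := D y; have Dz := D z.
have -> : hat n.+2 = fun s =>
    (y - x)^-1 * (spline n.+2 e (s - x) - spline n.+2 e (s - y)) -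
    (z - y)^-1 * (spline n.+2 e (s - y) - spline n.+2 e (s - z)).
  by apply/funext => t; rewrite /hat mulrC [X in _ - X]mulrC.
apply: (is_derive_eq (is_deriveB (is_deriveZ _ (is_deriveB Dx Dy))
  (is_deriveZ _ (is_deriveB Dy Dz)))).
by rewrite /hat /GRing.scale/= mulrC [X in _ - X]mulrC.
Qed.

Lemma derive1_hat (n : nat) : (hat n.+2)^`() = hat n.+1.
Proof.
apply/funext => s; rewrite derive1E.
by have [_ ->] := is_derive_hat n s.
Qed.

Lemma continuous_hat (n : nat) : continuous (hat n.+1).
Proof.
have c t : continuous (fun s => spline n.+1 e (s - t)).
  move=> s; apply: (@continuous_comp _ _ _ (fun s => s - t) (spline n.+1 e)).
    by apply: cvgB; [exact: cvg_id|exact: cvg_cst].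
  exact: continuous_spline.
by move=> s; apply: cvgB; apply: cvgMl; apply: cvgB; exact: c.
Qed.

Lemma hat_eq0_le (n : nat) (s : R) : s <= x -> hat n.+1 s = 0.
Proof.
move=> sx; rewrite /hat !spline_le0 ?subrr ?mul0r ?subrr//.
- by have := lt_trans xy yz; lra.
- by move: xy; lra.
- by lra.
Qed.

Lemma hat2_eq0_ge (s : R) : z + 2 * e <= s -> hat 2 s = 0.
Proof.
by move=> sz; rewrite /hat !spline2_ge ?subrr ?mul0r ?subrr//; move: xy yz; lra.
Qed.

(** To the right of all the knots the splines are affine, and second divided
    differences kill affine functions. *)
Lemma hat3_eq0_ge (s : R) : z + 2 * e <= s -> hat 3 s = 0.
Proof.
move=> sz; rewrite /hat !spline3_ge//; try by move: xy yz; lra.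
by field; rewrite !gt_eqF ?subr_gt0.
Qed.

Lemma normr_hat3_le1 (s : R) : `|hat 3 s| <= 1.
Proof.
have slope u v : u < v ->
    0 <= (spline 3 e (s - u) - spline 3 e (s - v)) / (v - u) <= 1.
  move=> uv; have vu : 0 < v - u by rewrite subr_gt0.
  have /andP[h1 h2] : 0 <= spline 3 e (s - u) - spline 3 e (s - v)
      <= (s - u) - (s - v) by apply: spline3_lipschitz => //; lra.
  by rewrite divr_ge0 ?(ltW vu)//= ler_pdivrMr// mul1r; lra.
have /andP[h1 h2] := slope _ _ xy; have /andP[h3 h4] := slope _ _ yz.
by rewrite ler_norml /hat; apply/andP; split; lra.
Qed.

(** The vanishing on the right is a hypothesis because [hat n.+2] has compact
    support only for small [n]; it is used for [hat 2] and [hat 3]. *)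
Lemma test_function_hat (a b : R) (n : nat) :
  (forall s, z + 2 * e <= s -> hat n.+2 s = 0) ->
  a < x -> z + 2 * e < b -> test_function a b (hat n.+2).
Proof.
move=> h0 ax zb; split.
- by move=> s; have [] := is_derive_hat n s.
- by rewrite derive1_hat; exact: continuous_hat.
- exists `[x, z + 2 * e]; split; first exact: segment_compact.
  + by apply: subset_itv; rewrite bnd_simp.
  + move=> s /= /negP; rewrite in_itv/= negb_and -!ltNge => /orP[/ltW sx|/ltW sz].
      exact: hat_eq0_le.
    exact: h0.
Qed.

Lemma weak_derivative2_hat (a b : R) (f f' f'' : R -> R) :
  weak_derivative a b f f' -> weak_derivative a b f' f'' ->
  a < x -> z + 2 * e < b ->
  \int[mu]_(s in `]a, b[) (f s * hat 1 s) =
  \int[mu]_(s in `]a, b[) (f'' s * hat 3 s).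
Proof.
move=> ff' ff'' ax zb.
have := ff' _ (test_function_hat hat2_eq0_ge ax zb).
rewrite derive1_hat => ->.
have := ff'' _ (test_function_hat hat3_eq0_ge ax zb).
by rewrite derive1_hat => ->; rewrite opprK.
Qed.

End Hat.

Section Approximation.
Context {R : realType}.
Notation mu := (@lebesgue_measure R).

Lemma integrable_oo (a b : R) (h : R -> R) :
  {within `[a, b], continuous h} -> mu.-integrable `]a, b[ (EFin \o h).
Proof.
move=> ch; have hi : mu.-integrable `[a, b] (EFin \o h).
  by apply: continuous_compact_integrable => //; exact: segment_compact.
by apply: integrableS hi => //; apply: subset_itv; rewrite bnd_simp.
Qed.

Lemma integrable_normr (D : set R) (h : R -> R) :
  mu.-integrable D (EFin \o h) -> mu.-integrable D (EFin \o (fun s => `|h s|)).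
Proof. exact: integrable_abse. Qed.

Lemma continuous_shifted_spline (n : nat) (e t : R) :
  continuous (fun s => spline n.+1 e (s - t)).
Proof.
move=> s; apply: (@continuous_comp _ _ _ (fun s => s - t) (spline n.+1 e)).
  by apply: cvgB; [exact: cvg_id|exact: cvg_cst].
exact: continuous_spline.
Qed.

Lemma integrable_mul_spline (a b e t : R) (f : R -> R) :
  {within `[a, b], continuous f} ->
  mu.-integrable `]a, b[ (EFin \o (fun s => f s * spline 1 e (s - t))).
Proof.
move=> cf; apply: integrable_oo => s.
have cs : {within `[a, b], continuous (fun s => spline 1 e (s - t))}.
  exact/continuous_subspaceT/continuous_shifted_spline.
exact: continuousM (cf s) (cs s).
Qed.

Lemma integral_spline1 (a b e t : R) : 0 < e -> a < t -> t + 2 * e < b ->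
  \int[mu]_(s in `]a, b[) spline 1 e (s - t) = 1.
Proof.
move=> e0 at_ tb; have ab : a < b by lra.
have [cF F'] := spline_antiderivative 0 t a b e0.
have cf : {within `[a, b], continuous (fun s => spline 1 e (s - t))}.
  exact/continuous_subspaceT/continuous_shifted_spline.
have dF : derivable_oo_LRcontinuous (fun s => spline 2 e (s - t)) a b.
  have /(continuous_within_itvP _ ab)[_ c1 c2] := cF.
  by split=> // s; rewrite in_itv/= => sab; have [] := F' s sab.
have F'E : {in `]a, b[%R, (fun s => spline 2 e (s - t))^`() =1
                          (fun s => spline 1 e (s - t))}.
  move=> s; rewrite in_itv/= => sab; rewrite derive1E.
  by have [_ ->] := F' s sab.
have := @continuous_FTC2 R _ (fun s => spline 2 e (s - t)) a b ab cf dF F'E.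
rewrite (spline2_ge (e := e) (s := b - t))//; last lra.
rewrite (spline_le0 1 (e := e) (s := a - t))//; last lra.
rewrite sube0 => h; rewrite /Rintegral -(integral_itv_bndoo true false).
  by rewrite h.
by have /measurable_int := integrable_oo cf.
Qed.

(** [spline 1 e] is an approximate identity, so the point values of a
    continuous function are limits of integrals. *)
Lemma spline_approximation (a b t eta : R) (f : R -> R) :
  {within `[a, b], continuous f} -> a < t < b -> 0 < eta ->
  \forall e \near 0^'+,
    `|\int[mu]_(s in `]a, b[) (f s * spline 1 e (s - t)) - f t| <= eta.
Proof.
move=> cf /andP[at_ tb] eta0.
have /(continuous_within_itvP _ (lt_trans at_ tb))[cof _ _] := cf.
have /cof/cvgrPdist_le/(_ _ eta0) : t \in `]a, b[%R by rewrite in_itv/= at_.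
move=> [d /= d0 df].
near=> e.
have e0 : 0 < e by near: e; exact: nbhs_right_gt.
have tb2 : t + 2 * e < b.
  suff : e < (b - t) / 2 by lra.
  by near: e; apply: nbhs_right_lt; lra.
have ed : 2 * e < d.
  suff : e < d / 2 by lra.
  by near: e; apply: nbhs_right_lt; lra.
have i1 := @integrable_mul_spline a b e t f cf.
have i3 : mu.-integrable `]a, b[ (EFin \o (fun s => spline 1 e (s - t))).
  exact/integrable_oo/continuous_subspaceT/continuous_shifted_spline.
have iZ c : mu.-integrable `]a, b[ (EFin \o (fun s => c * spline 1 e (s - t))).
  exact: (integrableZl _ _ i3).
have iB : mu.-integrable `]a, b[
    (EFin \o (fun s => f s * spline 1 e (s - t) - f t * spline 1 e (s - t))).
  exact: (integrableB _ i1 (iZ (f t))).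
have ft : f t = \int[mu]_(s in `]a, b[) (f t * spline 1 e (s - t)).
  by rewrite RintegralZl// integral_spline1// mulr1.
rewrite [X in _ - X]ft -RintegralB//.
apply: (le_trans (le_normr_Rintegral _ iB)) => //.
rewrite -[leRHS]mulr1 -(integral_spline1 e0 at_ tb2) -RintegralZl//.
apply: le_Rintegral => //; first exact: integrable_normr iB.
- move=> s sab; rewrite -mulrBl normrM (ger0_norm (spline1_ge0 _ e0)).
  have [st|st] := leP (s - t) 0; first by rewrite spline_le0// !mulr0.
  have [st2|st2] := leP (2 * e) (s - t); first by rewrite spline1_ge// !mulr0.
  rewrite ler_wpM2r ?spline1_ge0//.
  by rewrite distrC; apply: df => /=; rewrite distrC ger0_norm; lra.
Unshelve. all: by end_near. Qed.

End Approximation.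

(** * Regularity of H^2 functions *)

Section Sobolev.
Context {R : realType}.
Notation mu := (@lebesgue_measure R).

(** On a bounded interval [|g| <= 1 + |g| ^ 2]. *)
Lemma L2_integrable (a b : R) (g : R -> R) :
  L2 a b g -> mu.-integrable `]a, b[ (EFin \o g).
Proof.
move=> g2; have one_le2 : (1 : R) <= 2 by rewrite ler1n.
have g2' := Lfun_integrable one_le2 g2.
have /andP[/[!inE]/= mg _] := g2.
have mI : measurable (`]a, b[ : set (measurableTypeR R)) by [].
have c1 : mu.-integrable `]a, b[ (EFin \o cst (1 : R)).
  by apply: integrable_oo => ?; exact: cvg_cst.
have g2I := integrableS measurableT mI (@subsetT _ `]a, b[) g2'.
apply: (@le_integrable _ _ _ _ _ mI _ _ _ _ (integrableD mI c1 g2I)).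
  by apply/measurable_EFinP; exact/(measurable_restrictT g mI).
move=> x /mem_set xI; rewrite /= patchE xI lee_fin.
rewrite powR_mulrn// [leRHS]ger0_norm ?addr_ge0 ?sqr_ge0//.
have := sqr_ge0 (`|g x| - 1); have := normr_ge0 (g x); nra.
Qed.

Lemma normr_integral_mul_hat3 (a b e x y z : R) (g : R -> R) :
  0 < e -> x < y -> y < z -> a < x -> z + 2 * e < b ->
  mu.-integrable `]a, b[ (EFin \o g) ->
  `|\int[mu]_(s in `]a, b[) (g s * hat e x y z 3 s)| <=
  \int[mu]_(s in `]x, z + 2 * e]) `|g s|.
Proof.
move=> e0 xy yz ax zb gi.
have mI : measurable (`]a, b[ : set (measurableTypeR R)) by [].
set w := z + 2 * e.
have sub : `]x, w] `<=` `]a, b[ by apply: subset_itv; rewrite bnd_simp// ltW.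
have bd s : `|g s * hat e x y z 3 s| <= ((fun s => `|g s|) \_ `]x, w]) s.
  rewrite patchE mem_setE in_itv/=.
  have [xs|sx] := ltP x s; last by rewrite hat_eq0_le// mulr0 normr0.
  have [sw|ws] := leP s w; last by rewrite hat3_eq0_ge ?(ltW ws)// mulr0 normr0.
  by rewrite normrM ler_piMr// normr_hat3_le1.
have ghi : mu.-integrable `]a, b[ (EFin \o (fun s => g s * hat e x y z 3 s)).
  apply: (le_integrable mI _ _ gi).
    apply/measurable_EFinP/measurable_funM.
      by apply/measurable_EFinP; exact: measurable_int gi.
    apply: measurable_funTS; apply: continuous_measurable_fun.
    exact: continuous_hat.
  by move=> s _; rewrite lee_fin normrM ler_piMr// normr_hat3_le1.
apply: (le_trans (le_normr_Rintegral mI ghi)).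
have -> : \int[mu]_(s in `]x, w]) `|g s| =
    \int[mu]_(s in `]a, b[) ((fun s => `|g s|) \_ `]x, w]) s.
  by rewrite -Rintegral_mkcondr setIidr.
apply: le_Rintegral => //; first exact: integrable_normr ghi.
rewrite -restrict_EFin; apply/integrable_restrict => //.
by rewrite setIidr//; apply: integrableS (integrable_normr gi).
Qed.

Lemma divB_close (p q r s t h : R) : 0 < t -> `|p - q| <= h -> `|r - s| <= h ->
  `|(p - r) / t - (q - s) / t| <= 2 * h / t.
Proof.
move=> t0 pq rs; rewrite -mulrBl normrM normfV (gtr0_norm t0) ler_pM2r ?invr_gt0//.
have -> : p - r - (q - s) = (p - q) - (r - s) by ring.
by rewrite (le_trans (ler_normB _ _))// [leRHS]mulrDl mul1r lerD.
Qed.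

Definition slope (f : R -> R) (x y : R) := (f y - f x) / (y - x).

(** As [e] tends to [0], testing the second weak derivative against [hat]
    expresses the difference of two adjacent slopes of [f] by an integral of
    [f''] over the two intervals.  The function [N] is a primitive of [|f''|];
    what matters is that it is continuous. *)
Lemma H2_slope_variation (a b : R) (f : R -> R) : a < b -> H2 a b f ->
  exists2 N : R -> R, {within `[a, b], continuous N} &
  forall x y z, a < x -> x < y -> y < z -> z < b ->
    `|slope f y z - slope f x y| <= N z - N x.
Proof.
move=> ab [cf [f' [g [_ _ /L2_integrable gi ff' f'g]]]].
have mI : measurable (`]a, b[ : set (measurableTypeR R)) by [].
pose G := (fun s => `|(g \_ `]a, b[) s|).
have Gi D : measurable D -> mu.-integrable D (EFin \o G).
  move=> mD; apply: (@integrableS _ _ _ _ setT) => //.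
  apply: integrable_normr; rewrite -restrict_EFin.
  by have [h _] := integrable_mkcond (mu := mu) (EFin \o g) mI; exact: h.
pose N x := \int[mu]_(s in `[a, x]) G s.
have cN : {within `[a, b], continuous N}.
  by apply: parameterized_integral_continuous; [exact: ltW|exact: Gi].
have NB x y : a < x -> x <= y -> y < b ->
    N y - N x = \int[mu]_(s in `]x, y]) `|g s|.
  move=> ax xy yb; rewrite /N Rintegral_itvB ?bnd_simp ?(ltW ax)//; last exact: Gi.
  apply: eq_Rintegral => s; rewrite inE/= in_itv/= => /andP[xs sy].
  by rewrite /G patchE mem_setE in_itv/= (lt_trans ax xs) (le_lt_trans sy yb).
exists N => // x y z ax xy yz zb; apply/ler_addgt0Pr => eta eta0.
have yx0 : 0 < y - x by rewrite subr_gt0.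
have zy0 : 0 < z - y by rewrite subr_gt0.
(* The errors made on [N] and on the three point values add up to [C * h]. *)
pose C := 1 + 2 / (y - x) + 2 / (z - y).
have C0 : 0 < C by rewrite !addr_gt0// divr_gt0.
pose h := eta / C; have h0 : 0 < h by rewrite divr_gt0.
have xab : a < x < b by rewrite ax/=; lra.
have yab : a < y < b by apply/andP; lra.
have zab : a < z < b by apply/andP; lra.
have [d /= d0 dN] : \forall t \near z, `|N z - N t| <= h.
  have /(continuous_within_itvP _ ab)[cN' _ _] := cN.
  have /cN'/cvgrPdist_le : z \in `]a, b[%R by rewrite in_itv/=.
  exact.
have Jx := spline_approximation cf xab h0.
have Jy := spline_approximation cf yab h0.
have Jz := spline_approximation cf zab h0.
near (0 : R)^'+ => e.
have e0 : 0 < e by near: e; exact: nbhs_right_gt.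
have zeb : z + 2 * e < b.
  suff : e < (b - z) / 2 by lra.
  by near: e; apply: nbhs_right_lt; lra.
have ed : 2 * e < d.
  suff : e < d / 2 by lra.
  by near: e; apply: nbhs_right_lt; lra.
have : `|\int[mu]_(s in `]a, b[) (f s * spline 1 e (s - x)) - f x| <= h.
  by near: e; exact: Jx.
have : `|\int[mu]_(s in `]a, b[) (f s * spline 1 e (s - y)) - f y| <= h.
  by near: e; exact: Jy.
have : `|\int[mu]_(s in `]a, b[) (f s * spline 1 e (s - z)) - f z| <= h.
  by near: e; exact: Jz.
have Nz : N (z + 2 * e) - N z <= h.
  have /dN : `|z - (z + 2 * e)| < d.
    by rewrite distrC addrAC subrr add0r ger0_norm//; lra.
  by rewrite distrC; apply: le_trans; exact: ler_norm.
have := normr_integral_mul_hat3 e0 xy yz ax zeb gi.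
rewrite -(weak_derivative2_hat e0 xy yz ff' f'g ax zeb) -NB//; last by lra.
have is_ t := @integrable_mul_spline _ a b e t f cf.
set Ix := \int[mu]_(s in `]a, b[) (f s * spline 1 e (s - x)).
set Iy := \int[mu]_(s in `]a, b[) (f s * spline 1 e (s - y)).
set Iz := \int[mu]_(s in `]a, b[) (f s * spline 1 e (s - z)).
have -> : \int[mu]_(s in `]a, b[) (f s * hat e x y z 1 s) =
    (Ix - Iy) / (y - x) - (Iy - Iz) / (z - y).
  have iB u v : mu.-integrable `]a, b[ (EFin \o
      (fun s => f s * spline 1 e (s - u) - f s * spline 1 e (s - v))).
    exact: (integrableB mI (is_ u) (is_ v)).
  have iZ c u v : mu.-integrable `]a, b[ (EFin \o
      (fun s => c * (f s * spline 1 e (s - u) - f s * spline 1 e (s - v)))).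
    exact: (integrableZl mI c (iB u v)).
  rewrite mulrC [X in _ - X]mulrC /Ix /Iy /Iz -!RintegralB// -!RintegralZl//.
  rewrite -RintegralB//; apply: eq_Rintegral => s _; rewrite /hat; ring.
move=> J1.
have hC : h + 2 * h / (y - x) + 2 * h / (z - y) = eta.
  rewrite -[RHS](divfK (lt0r_neq0 C0)) -/h /C; ring.
move=> z1 y1 x1.
have A1 := divB_close yx0 x1 y1; have A2 := divB_close zy0 y1 z1.
have D : slope f y z - slope f x y =
    (Ix - Iy) / (y - x) - (Iy - Iz) / (z - y)
    - ((Ix - Iy) / (y - x) - (f x - f y) / (y - x))
    + ((Iy - Iz) / (z - y) - (f y - f z) / (z - y)) by rewrite /slope; ring.
rewrite D -hC.
apply: (le_trans (ler_normD _ _)).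
apply: (le_trans (lerD (le_trans (ler_normB _ _) (lerD J1 A1)) A2)).
rewrite !addrA !lerD2r addrAC lerD2r.
by rewrite -lerBlDl.
Unshelve. all: by end_near. Qed.

End Sobolev.
Lemma continuous_itv_bounded (R : realType) (a b : R) (g : R -> R) :
  a < b -> {within `[a, b], continuous g} ->
  exists B, forall x, a <= x <= b -> `|g x| <= B.
Proof.
move=> ab cg; have [p _ pm] := EVT_max (ltW ab) cg.
have [q _ qm] := EVT_min (ltW ab) cg.
exists (`|g p| + `|g q|) => x xab.
have xI : x \in `[a, b]%R by rewrite in_itv.
have := pm _ xI; have := qm _ xI => h1 h2.
rewrite ler_norml; apply/andP; split.
  have := ler_norm (- g q); rewrite normrN; have := normr_ge0 (g p); lra.
have := ler_norm (g p); have := normr_ge0 (g q); lra.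
Qed.

(** The consequences of a slope variation dominated by the increments of a
    continuous function. *)
Section SlopeVariation.
Context {R : realType}.
Variables (a b : R) (f N : R -> R).
Hypothesis ab : a < b.
Hypothesis cN : {within `[a, b], continuous N}.
Hypothesis slope_variation : forall x y z, a < x -> x < y -> y < z -> z < b ->
  `|slope f y z - slope f x y| <= N z - N x.

Let quotient y h := h^-1 *: (f (h *: 1 + y) - f y).

Let quotient_gt y h : 0 < h -> quotient y h = slope f y (y + h).
Proof.
move=> h0; rewrite /quotient /slope /GRing.scale/= mulr1 [h + y]addrC.
have -> : y + h - y = h by ring.
by rewrite mulrC.
Qed.

Let quotient_lt y h : h < 0 -> quotient y h = slope f (y + h) y.
Proof.
move=> h0; rewrite /quotient /slope /GRing.scale/= mulr1 [h + y]addrC.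
have -> : y - (y + h) = - h by ring.
by rewrite invrN mulrN -mulNr opprB mulrC.
Qed.

(** Two difference quotients on the same side of [y] are compared through one
    on the other side; the continuity of [N] makes them Cauchy. *)
Lemma slope_variation_derivable y : a < y < b -> derivable f y 1.
Proof.
move=> /andP[ay yb]; apply: cauchy_cvg; apply: cauchy_exP => e e0.
have e50 : 0 < e / 5 by rewrite divr_gt0.
have [d /= d0 dN] : \forall t \near y, `|N y - N t| <= e / 5.
  have /(continuous_within_itvP _ ab)[cN' _ _] := cN.
  have /cN'/cvgrPdist_le : y \in `]a, b[%R by rewrite in_itv/= ay.
  exact.
(* Halved, so that the reference points [y - k] and [y + k] stay in the
   interval and in the ball where [N] is close to [N y]. *)
pose k := Num.min d (Num.min (y - a) (b - y)) / 2.
have [k0 kd ka kb] : [/\ 0 < k, k < d, k < y - a & k < b - y].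
  have m0 : 0 < Num.min d (Num.min (y - a) (b - y)).
    by rewrite !lt_min d0 !subr_gt0 ay yb.
  have m1 : Num.min d (Num.min (y - a) (b - y)) <= d by rewrite ge_min lexx.
  have m2 : Num.min d (Num.min (y - a) (b - y)) <= y - a.
    by rewrite !ge_min lexx orbT.
  have m3 : Num.min d (Num.min (y - a) (b - y)) <= b - y.
    by rewrite !ge_min lexx !orbT.
  by rewrite /k; split; lra.
have var l r : - k <= l -> l < 0 -> 0 < r -> r <= k ->
    `|slope f y (y + r) - slope f (y + l) y| <= 2 * (e / 5).
  move=> kl l0 r0 rk; apply: (le_trans (slope_variation _ _ _ _)); try lra.
  have /dN : `|y - (y + l)| < d.
    by rewrite opprD addNKr normrN ltr0_norm//; lra.
  have /dN : `|y - (y + r)| < d.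
    by rewrite opprD addNKr normrN gtr0_norm//; lra.
  by rewrite !ler_norml => /andP[? ?] /andP[? ?]; lra.
exists (slope f y (y + k)).
exists k => //= h /=; rewrite sub0r normrN => hk h0.
rewrite -/(quotient y h) /ball/=.
have [{}h0|{}h0|/eqP] := ltgtP h 0; last by rewrite (negPf h0).
- rewrite quotient_lt//; rewrite ltr0_norm// in hk.
  by apply: le_lt_trans (var _ _ _ _ _ _) _ => //; lra.
- rewrite quotient_gt//; rewrite gtr0_norm// in hk.
  have := var (- k) k; have := var (- k) h.
  rewrite lexx oppr_lt0 k0 => /(_ isT isT h0 (ltW hk)) h1.
  move=> /(_ isT isT isT (lexx _)) h2.
  rewrite -(subrK (slope f (y - k) y) (slope f y (y + k))) -addrA.
  apply: le_lt_trans (ler_normD _ _) _.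
  rewrite [X in _ + X]distrC; lra.
Qed.

(** A slope over a short interval differs by a bounded amount from the slope of
    an adjacent interval whose length is a fixed fraction of [b - a], and the
    latter slope is bounded because [f] is. *)
Lemma slope_variation_derive_bounded : {within `[a, b], continuous f} ->
  exists A, forall y, a < y < b -> `|f^`()%classic y| <= A.
Proof.
move=> cf.
have [B fB] := continuous_itv_bounded ab cf.
have [E NE] := continuous_itv_bounded ab cN.
have D0 : 0 < b - a by rewrite subr_gt0.
have B0 : 0 <= B.
  by apply: le_trans (normr_ge0 (f a)) (fB a _); rewrite lexx ltW.
exists (8 * B / (b - a) + 2 * E) => y /[dup] yab /andP[ay yb].
have dy := slope_variation_derivable yab.
have cq : quotient y h @[h --> 0^'] --> f^`()%classic y.
  by rewrite derive1E; exact: dy.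
have slopeB u v : a < u -> v < b -> (b - a) / 4 <= v - u ->
    `|slope f u v| <= 8 * B / (b - a).
  move=> au vb uv; have uv0 : 0 < v - u by lra.
  rewrite /slope normrM normfV (gtr0_norm uv0) ler_pdivrMr//.
  apply: (@le_trans _ _ (2 * B)).
    apply: (le_trans (ler_normB _ _)); rewrite mulrDl mul1r.
    by apply: lerD; apply: fB; apply/andP; split; lra.
  have := ler_wpM2l (_ : 0 <= 8 * B / (b - a)) uv.
  have -> : 8 * B / (b - a) * ((b - a) / 4) = 2 * B by field; rewrite gt_eqF.
  by apply; rewrite divr_ge0 ?(ltW D0)// mulr_ge0.
have varE x t z : a < x -> x < t -> t < z -> z < b ->
    `|slope f t z - slope f x t| <= 2 * E.
  move=> ax xt tz zb; apply: (le_trans (slope_variation ax xt tz zb)).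
  have NEx : `|N x| <= E by apply: NE; lra.
  have NEz : `|N z| <= E by apply: NE; lra.
  have := ler_norm (N z); have := ler_norm (- N x); rewrite normrN; lra.
have slope_near h : 0 < h -> h < (b - y) / 2 -> h < (b - a) / 8 ->
    `|slope f y (y + h)| <= 8 * B / (b - a) + 2 * E.
  move=> h0 hb hD; have [ym|my] := leP y ((a + b) / 2).
  - pose z := b - (b - a) / 8.
    have s1 : `|slope f (y + h) z| <= 8 * B / (b - a).
      by apply: slopeB; rewrite /z; lra.
    have v1 : `|slope f (y + h) z - slope f y (y + h)| <= 2 * E.
      by apply: varE; rewrite /z; lra.
    rewrite -[slope f y (y + h)](subKr (slope f (y + h) z)).
    by rewrite (le_trans (ler_normB _ _))// lerD.
  - pose z := a + (b - a) / 8.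
    have s1 : `|slope f z y| <= 8 * B / (b - a).
      by apply: slopeB; rewrite /z; lra.
    have v1 : `|slope f y (y + h) - slope f z y| <= 2 * E.
      by apply: varE; rewrite /z; lra.
    rewrite -[slope f y (y + h)](subrKC (slope f z y)).
    by rewrite (le_trans (ler_normD _ _))// lerD.
apply/ler_addgt0Pr => e e0.
have [d /= d0 dP] : \forall h \near 0^', `|f^`()%classic y - quotient y h| <= e.
  by have /cvgrPdist_le := cq; exact.
near (0 : R)^'+ => h.
have h0 : 0 < h by near: h; exact: nbhs_right_gt.
have hb : h < (b - y) / 2 by near: h; apply: nbhs_right_lt; lra.
have hD : h < (b - a) / 8 by near: h; apply: nbhs_right_lt; lra.
have hd : h < d by near: h; exact: nbhs_right_lt.
have qe : `|f^`()%classic y - quotient y h| <= e.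
  by apply: dP; rewrite /= ?gt_eqF// sub0r normrN gtr0_norm.
rewrite -[f^`()%classic y](subrK (quotient y h)) addrC.
rewrite (le_trans (ler_normD _ _))// lerD// quotient_gt//.
exact: slope_near.
Unshelve. all: by end_near. Qed.

End SlopeVariation.

Lemma H2_derivable_bounded (R : realType) (a b : R) (f : R -> R) :
  a < b -> H2 a b f ->
  exists2 A, antiderivative_on a b f f^`()%classic &
    forall y, a < y < b -> `|f^`()%classic y| <= A.
Proof.
move=> ab fH2; have [cf _] := fH2.
have [N cN var] := H2_slope_variation ab fH2.
have [A fA] := slope_variation_derive_bounded ab cN var cf.
exists A => //; split=> // y yab; rewrite derive1E.
exact/derivableP/(slope_variation_derivable ab cN var).
Qed.

(** * Energy estimates on one side *)

Definition weights_bounded {R : realType} (m L : R)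
    (rho drho tau dtau q : R -> R) :=
  [/\ antiderivative_on (-1) 0 rho drho, antiderivative_on (-1) 0 tau dtau,
      (forall x, -1 <= x <= 0 -> m <= rho x <= L /\ m <= tau x <= L) &
      (forall x, -1 < x < 0 ->
        [/\ `|drho x| <= L, `|dtau x| <= L & 0 <= q x <= L])].

(** The source [h] makes room for differences of two solutions of [state] with
    distinct spectral parameters. *)
Definition forced_state {R : realType} (rho tau q : R -> R) (nu : R)
    (h f p : R -> R) :=
  antiderivative_on (-1) 0 f (fun x => tau x * p x) /\
  antiderivative_on (-1) 0 p (fun x => (q x - nu * rho x) * f x - h x).

Definition state {R : realType} (rho tau q : R -> R) (nu : R) (f p : R -> R) :=
  antiderivative_on (-1) 0 f (fun x => tau x * p x) /\
  antiderivative_on (-1) 0 p (fun x => (q x - nu * rho x) * f x).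

(** A substitute for the energy that does not involve the coefficients. *)
Definition amplitude {R : realType} (nu : R) (f p : R -> R) (x : R) :=
  p x ^+ 2 + nu * f x ^+ 2.

Lemma amplitude_ge0 {R : realType} (nu : R) f p x :
  0 <= nu -> 0 <= amplitude nu f p x.
Proof. by move=> ?; rewrite addr_ge0 ?sqr_ge0// mulr_ge0// sqr_ge0. Qed.

Lemma norm_mul2_le (R : realDomainType) (x y : R) :
  `|2 * x * y| <= x ^+ 2 + y ^+ 2.
Proof.
have := sqr_ge0 (x + y); have := sqr_ge0 (x - y).
by rewrite ler_norml => ? ?; apply/andP; split; lra.
Qed.

(** The pointwise form of the energy inequality.  Its point is that the constant
    in front of the energy does not grow with [nu]. *)
Lemma energy_rate (R : realFieldType) (m L n0 nu r t dr dt q f p h : R) :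
  0 < m -> m <= r -> m <= t -> t <= L -> `|dr| <= L -> `|dt| <= L ->
  0 <= q <= L -> 0 < n0 -> n0 <= nu ->
  `|dt * p ^+ 2 + nu * dr * f ^+ 2 + 2 * t * q * p * f - 2 * t * p * h|
  <= (L / m + L + L ^+ 2 / (m * n0) + 1) * (t * p ^+ 2 + nu * r * f ^+ 2)
     + L * h ^+ 2.
Proof.
move=> m0 mr mt tL drL dtL /andP[q0 qL] n00 n0nu.
have nu0 : 0 < nu by exact: (lt_le_trans n00 n0nu).
have t0 : 0 < t by exact: (lt_le_trans m0 mt).
have r0 : 0 < r by exact: (lt_le_trans m0 mr).
have L0 : 0 < L by exact: (lt_le_trans t0 tL).
set X := t * p ^+ 2; set Y := nu * r * f ^+ 2.
have X0 : 0 <= X by rewrite mulr_ge0 ?sqr_ge0// ltW.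
have Y0 : 0 <= Y by rewrite mulr_ge0 ?sqr_ge0// mulr_ge0// ltW.
have pX : p ^+ 2 <= X / m.
  by rewrite ler_pdivlMr// mulrC ler_wpM2r ?sqr_ge0.
have fY : f ^+ 2 <= Y / (m * n0).
  rewrite ler_pdivlMr ?mulr_gt0// mulrC; apply: ler_wpM2r; first exact: sqr_ge0.
  by rewrite mulrC ler_pM// ltW.
have T1 : `|dt * p ^+ 2| <= L / m * X.
  have -> : L / m * X = L * (X / m) by ring.
  by rewrite normrM (ger0_norm (sqr_ge0 _)) ler_pM// sqr_ge0.
have T2 : `|nu * dr * f ^+ 2| <= L / m * Y.
  have -> : L / m * Y = L * (nu * (r / m) * f ^+ 2) by rewrite /Y; ring.
  have -> : nu * dr * f ^+ 2 = dr * (nu * f ^+ 2) by ring.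
  have g0 : 0 <= nu * f ^+ 2 by rewrite mulr_ge0 ?sqr_ge0 ?ltW.
  rewrite normrM (ger0_norm g0) ler_pM// ler_wpM2r ?sqr_ge0//.
  by rewrite ler_peMr ?(ltW nu0)// ler_pdivlMr// mul1r.
have T3 : `|2 * t * q * p * f| <= L * X + L ^+ 2 / (m * n0) * Y.
  have -> : 2 * t * q * p * f = (t * q) * (2 * p * f) by ring.
  rewrite normrM (@ger0_norm _ (t * q)) ?mulr_ge0 ?(ltW t0)//.
  have H := norm_mul2_le p f.
  have -> : L ^+ 2 / (m * n0) * Y = L * L * (Y / (m * n0)) by ring.
  apply: (@le_trans _ _ (t * q * (p ^+ 2 + f ^+ 2))).
    by rewrite ler_wpM2l// mulr_ge0// ltW.
  rewrite mulrDr lerD//.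
    have -> : t * q * p ^+ 2 = q * X by rewrite /X; ring.
    by rewrite ler_wpM2r.
  have t0' := ltW t0.
  by apply: ler_pM fY; [exact: mulr_ge0|exact: sqr_ge0|exact: ler_pM].
have T4 : `|2 * t * p * h| <= X + L * h ^+ 2.
  have -> : 2 * t * p * h = t * (2 * p * h) by ring.
  rewrite normrM (ger0_norm (ltW t0)).
  have H := norm_mul2_le p h.
  apply: (@le_trans _ _ (t * (p ^+ 2 + h ^+ 2))).
    by rewrite ler_wpM2l// ltW.
  by rewrite mulrDr lerD// ler_wpM2r// sqr_ge0.
apply: (le_trans (ler_normB _ _)); apply: (le_trans (lerD (le_trans
  (ler_normD _ _) (lerD (le_trans (ler_normD _ _) (lerD T1 T2)) T3)) T4)).
have -> : L / m * X + L / m * Y + (L * X + L ^+ 2 / (m * n0) * Y)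
   + (X + L * h ^+ 2) = (L / m + L + L ^+ 2 / (m * n0) + 1) * (X + Y) + L * h ^+ 2
   - (L ^+ 2 / (m * n0) * X + L * Y + Y) by ring.
have mn0 : 0 <= (m * n0)^-1 by rewrite invr_ge0 ltW// mulr_gt0.
rewrite gerBl addr_ge0// addr_ge0//; last by rewrite mulr_ge0// ltW.
by apply: mulr_ge0 X0; apply: mulr_ge0 mn0; exact: sqr_ge0.
Qed.

Section OneSide.
Context {R : realType}.
Variables (m L n0 : R) (rho drho tau dtau q : R -> R).
Hypotheses (m_gt0 : 0 < m) (n0_gt0 : 0 < n0).
Hypothesis weights : weights_bounded m L rho drho tau dtau q.
Implicit Types (nu x y : R) (h f p : R -> R).

Let energy nu f p x := tau x * p x ^+ 2 + nu * rho x * f x ^+ 2.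

Let rate := L / m + L + L ^+ 2 / (m * n0) + 1.

Let L_gt0 : 0 < L.
Proof.
have [_ _ b _] := weights; have [] := b 0; first by rewrite lexx lerN10.
by move=> /andP[r1 r2] _; exact: lt_le_trans m_gt0 (le_trans r1 r2).
Qed.

Let rate_ge1 : 1 <= rate.
Proof.
rewrite /rate lerDr; apply: addr_ge0; first apply: addr_ge0.
- by rewrite divr_ge0// ltW.
- exact: ltW.
- by rewrite divr_ge0 ?sqr_ge0// ltW// mulr_gt0.
Qed.

Lemma state_forced nu f p : state rho tau q nu f p ->
  forced_state rho tau q nu (fun=> 0) f p.
Proof.
move=> [fE pE]; split=> //.
by apply: antiderivative_on_eq pE _ _ => // x; rewrite subr0.
Qed.

Lemma energy_antiderivative nu h f p : forced_state rho tau q nu h f p ->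
  antiderivative_on (-1) 0 (energy nu f p) (fun x =>
    dtau x * p x ^+ 2 + nu * drho x * f x ^+ 2 + 2 * tau x * q x * p x * f x
    - 2 * tau x * p x * h x).
Proof.
move=> [fE pE]; have [rE tE _ _] := weights.
have := antiderivative_onD
  (antiderivative_onM tE (antiderivative_onM pE pE))
  (antiderivative_onM (antiderivative_onZ nu rE) (antiderivative_onM fE fE)).
by move/antiderivative_on_eq; apply => // x _; ring.
Qed.

Lemma energy_rateP nu h f p x : n0 <= nu -> -1 < x < 0 ->
  `|dtau x * p x ^+ 2 + nu * drho x * f x ^+ 2 + 2 * tau x * q x * p x * f x
    - 2 * tau x * p x * h x| <= rate * energy nu f p x + L * h x ^+ 2.
Proof.
move=> n0nu x01; have [_ _ b1 b2] := weights.
have /b1 : -1 <= x <= 0 by move/andP: x01 => [/ltW -> /ltW ->].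
have [? ? ?] := b2 _ x01.
by move=> [/andP[? ?] /andP[? ?]]; exact: energy_rate.
Qed.

Lemma energy_amplitude nu f p x : n0 <= nu -> -1 <= x <= 0 ->
  m * amplitude nu f p x <= energy nu f p x <= L * amplitude nu f p x.
Proof.
move=> n0nu x01; have [_ _ b1 b2] := weights.
have [/andP[? ?] /andP[? ?]] := b1 _ x01.
have nu0 : 0 < nu by exact: (lt_le_trans n0_gt0 n0nu).
have E1 : 0 <= p x ^+ 2 by exact: sqr_ge0.
have E2 : 0 <= nu * f x ^+ 2 by rewrite mulr_ge0 ?sqr_ge0 ?ltW.
rewrite /amplitude /energy mulrAC [_ * _ * rho x]mulrC !mulrDr.
by apply/andP; split; apply: lerD; apply: ler_wpM2r.
Qed.

Lemma energy_comparable nu f p x y : n0 <= nu -> state rho tau q nu f p ->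
  -1 <= x <= 0 -> -1 <= y <= 0 ->
  energy nu f p x <= expR rate * energy nu f p y.
Proof.
move=> n0nu fp /andP[x1 x0] /andP[y1 y0].
have E' := energy_antiderivative (state_forced fp).
have rate_ge0 : 0 <= rate.
  exact/(le_trans ler01)/rate_ge1.
have E_ge0 z : -1 <= z -> z <= 0 -> 0 <= energy nu f p z.
  move=> z1 z0; have z01 : -1 <= z <= 0 by rewrite z1.
  have /andP[+ _] := energy_amplitude f p n0nu z01; apply: le_trans.
  have ? : 0 < nu by exact: (lt_le_trans n0_gt0 n0nu).
  by rewrite mulr_ge0 ?amplitude_ge0 ?ltW.
set D := (X in antiderivative_on _ _ _ X) in E'.
have bd z : -1 < z < 0 -> `|D z| <= rate * energy nu f p z.
  move=> z01; have := energy_rateP (fun=> 0) f p n0nu z01.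
  by rewrite (_ : L * _ = 0) ?addr0//= expr2 !mulr0.
have [xy|yx] := leP x y.
- have h : - energy nu f p y <= expR (- rate * (y - x)) * - energy nu f p x.
    apply: (gronwall_le (antiderivative_onN E')) => // z /bd.
    rewrite ler_norml => /andP[+ _].
    by rewrite mulrNN lerNl.
  move: h; rewrite mulrN mulNr lerN2.
  move=> /(ler_wpM2l (expR_ge0 (rate * (y - x)))).
  rewrite mulrA -expRD subrr expR0 mul1r => h; apply: (le_trans h).
  apply: ler_wpM2r; first exact: E_ge0.
  by rewrite ler_expR ler_piMr//; lra.
- have h : energy nu f p x <= expR (rate * (x - y)) * energy nu f p y.
    apply: (gronwall_le E' _ y1 (ltW yx) x0) => z /bd.
    by rewrite ler_norml => /andP[_].
  apply: (le_trans h).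
  apply: ler_wpM2r; first exact: E_ge0.
  by rewrite ler_expR ler_piMr//; lra.
Qed.

Lemma amplitude_comparable : exists2 C, 0 < C &
  forall nu f p x y, n0 <= nu -> state rho tau q nu f p ->
  -1 <= x <= 0 -> -1 <= y <= 0 ->
  amplitude nu f p x <= C * amplitude nu f p y.
Proof.
exists (expR rate * L / m).
  by rewrite divr_gt0// mulr_gt0// expR_gt0.
move=> nu f p x y n0nu fp x01 y01.
have h := energy_comparable n0nu fp x01 y01.
have /andP[h1 _] := energy_amplitude f p n0nu x01.
have /andP[_ h2] := energy_amplitude f p n0nu y01.
rewrite mulrAC ler_pdivlMr// mulrC (le_trans h1)// (le_trans h)// -mulrA.
by rewrite ler_wpM2l// expR_ge0.
Qed.

Lemma state_diff nu d u p w pw :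
  state rho tau q nu u p -> state rho tau q (nu + d) w pw ->
  forced_state rho tau q nu (fun x => d * rho x * w x)
    (fun x => w x - u x) (fun x => pw x - p x).
Proof.
move=> [uE pE] [wE pwE]; split.
- have := antiderivative_onD wE (antiderivative_onN uE).
  by move/antiderivative_on_eq; apply => // x _; ring.
- have := antiderivative_onD pwE (antiderivative_onN pE).
  by move/antiderivative_on_eq; apply => // x _; ring.
Qed.

(** The difference of the solutions starts with zero energy and is forced by
    [d * rho * w], whose square is of size [d ^ 2 / nu] relative to the
    amplitude. *)
Lemma perturbation_bound : exists2 C, 0 < C &
  forall nu d u p w pw x, n0 <= nu -> 0 < d <= 1 ->
  state rho tau q nu u p -> state rho tau q (nu + d) w pw ->
  w (-1) = u (-1) -> pw (-1) = p (-1) -> -1 <= x <= 0 ->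
  nu * amplitude nu (fun x => w x - u x) (fun x => pw x - p x) x
  <= C * d ^+ 2 * amplitude nu u p 0.
Proof.
have [C1 C10 cmp] := amplitude_comparable.
pose K := rate + 2 * L ^+ 3 / (m * n0).
pose B := 2 * L ^+ 3 * C1.
have L3 : 0 < L ^+ 3 by rewrite exprn_gt0.
have B0 : 0 < B by rewrite mulr_gt0// mulr_gt0.
have mn0 : 0 < (m * n0)^-1 by rewrite invr_gt0 mulr_gt0.
have K1 : 1 <= K.
  by rewrite /K (le_trans rate_ge1)// lerDl; rewrite ltW// mulr_gt0// mulr_gt0.
exists (expR K * B / m); first by rewrite divr_gt0// mulr_gt0// expR_gt0.
move=> nu d u p w pw x n0nu /andP[d0 d1] us ws iu ip x01.
have nu0 : 0 < nu by exact: (lt_le_trans n0_gt0 n0nu).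
have ds := state_diff us ws.
have E' := energy_antiderivative ds.
set S0 := amplitude nu u p 0.
set f := (fun x => w x - u x) in ds E' *.
set g := (fun x => pw x - p x) in ds E' *.
set D := (X in antiderivative_on _ _ _ X) in E'.
pose b := B * d ^+ 2 * S0 / nu.
have S00 : 0 <= S0 by apply: amplitude_ge0; exact: ltW.
have b0 : 0 <= b.
  by rewrite /b; apply: divr_ge0 (ltW nu0); do 2?apply: mulr_ge0 => //;
    [exact: ltW|exact: sqr_ge0].
have E_ge0 z : -1 <= z <= 0 -> m * amplitude nu f g z <= energy nu f g z.
  by move=> z01; have /andP[] := energy_amplitude f g n0nu z01.
have A_ge0 z : 0 <= amplitude nu f g z by exact/amplitude_ge0/ltW.
(* the source term is a small multiple of [w = u + f], and [u] and [f] are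
   controlled by the two energies *)
have rateD z : -1 < z < 0 -> D z <= K * (energy nu f g z + b).
  move=> z01; have z01' : -1 <= z <= 0 by move/andP: z01 => [/ltW -> /ltW ->].
  have := energy_rateP (fun x => d * rho x * w x) f g n0nu z01.
  rewrite ler_norml => /andP[_ /le_trans]; apply.
  have [_ _ b1 _] := weights; have [/andP[r1 r2] _] := b1 _ z01'.
  have r0 : 0 <= rho z by exact/ltW/(lt_le_trans m_gt0).
  have h1 : L * (d * rho z * w z) ^+ 2 <= 
            2 * L ^+ 3 * d ^+ 2 * (u z ^+ 2 + f z ^+ 2).
    have -> : L * (d * rho z * w z) ^+ 2 = L * d ^+ 2 * (rho z ^+ 2 * w z ^+ 2).
      by ring.
    have -> : 2 * L ^+ 3 * d ^+ 2 * (u z ^+ 2 + f z ^+ 2) =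
        L * d ^+ 2 * (L ^+ 2 * (2 * (u z ^+ 2 + f z ^+ 2))) by ring.
    apply: ler_wpM2l; first by rewrite mulr_ge0 ?sqr_ge0// ltW.
    apply: ler_pM; rewrite ?sqr_ge0//.
      by rewrite lerXn2r// nnegrE// ltW.
    rewrite /f; have := sqr_ge0 (w z - 2 * u z); lra.
  have h2 : u z ^+ 2 <= C1 * S0 / nu.
    rewrite ler_pdivlMr// mulrC.
    apply: (le_trans _ (cmp _ _ _ _ _ n0nu us z01' _)).
      by rewrite /amplitude lerDr sqr_ge0.
    by rewrite lexx lerN10.
  have h3 : f z ^+ 2 <= energy nu f g z / (m * n0).
    rewrite ler_pdivlMr ?mulr_gt0// (le_trans _ (E_ge0 _ z01'))//.
    rewrite mulrCA ler_wpM2l ?(ltW m_gt0)// mulrC.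
    rewrite (@le_trans _ _ (nu * f z ^+ 2))// ?ler_wpM2r ?sqr_ge0//.
    by rewrite /amplitude lerDr sqr_ge0.
  have d2 : d ^+ 2 <= 1 by rewrite expr_le1// ltW.
  have h4 : 2 * L ^+ 3 * d ^+ 2 * f z ^+ 2
      <= 2 * L ^+ 3 / (m * n0) * energy nu f g z.
    have -> : 2 * L ^+ 3 / (m * n0) * energy nu f g z =
      2 * L ^+ 3 * 1 * (energy nu f g z / (m * n0)) by ring.
    apply: ler_pM h3; rewrite ?sqr_ge0//.
      by rewrite mulr_ge0 ?sqr_ge0// mulr_ge0// ltW.
    by rewrite ler_wpM2l// mulr_ge0// ltW.
  have h5 : 2 * L ^+ 3 * d ^+ 2 * u z ^+ 2 <= b.
    have -> : b = 2 * L ^+ 3 * d ^+ 2 * (C1 * S0 / nu) by rewrite /b /B; ring.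
    by apply: ler_wpM2l h2; rewrite mulr_ge0 ?sqr_ge0// mulr_ge0// ltW.
  have h6 : b <= K * b by rewrite ler_peMl.
  rewrite [K * (_ + _)]mulrDr {1}/K [(_ + _) * energy _ _ _ _]mulrDl -/rate.
  rewrite mulrDr in h1.
  lra.
have Eb := antiderivative_onD E' (antiderivative_on_cst (-1) 0 b).
have /andP[x1 x0] := x01.
have := gronwall_le Eb (K := K) _ (lexx _) x1 x0.
have -> : energy nu f g (-1) = 0.
  by rewrite /energy /f /g iu ip !subrr expr0n/= !mulr0 addr0.
rewrite add0r => /(_ _)-h.
have {}h : energy nu f g x <= expR K * b.
  apply: (@le_trans _ _ (energy nu f g x + b)); first by rewrite lerDl.
  apply: le_trans (h _) _ => [z /rateD|]; first by rewrite addr0.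
  by rewrite ler_wpM2r// ler_expR ler_piMr; lra.
have -> : expR K * B / m * d ^+ 2 * S0 = nu * (expR K * b / m).
  by rewrite /b; field; rewrite !gt_eqF.
rewrite ler_wpM2l ?(ltW nu0)// ler_pdivlMr// mulrC.
exact: le_trans (E_ge0 _ x01) h.
Qed.

Lemma wronskian_antiderivative nu d u p w pw :
  state rho tau q nu u p -> state rho tau q (nu + d) w pw ->
  antiderivative_on (-1) 0 (fun x => p x * w x - u x * pw x)
    (fun x => d * rho x * u x * w x).
Proof.
move=> [uE pE] [wE pwE].
have := antiderivative_onD (antiderivative_onM pE wE)
  (antiderivative_onN (antiderivative_onM uE pwE)).
by move/antiderivative_on_eq; apply => // x _; ring.
Qed.

(** The virial function is cut off by [(x * (x + 1)) ^ 2], which vanishes at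
    both ends, so that no boundary term appears. *)
Lemma virial_antiderivative nu u p : state rho tau q nu u p ->
  antiderivative_on (-1) 0 (fun x => (x * (x + 1)) ^+ 2 * (p x * u x))
    (fun x => 2 * (x * (x + 1)) * (2 * x + 1) * (p x * u x) +
      (x * (x + 1)) ^+ 2 *
        ((q x - nu * rho x) * u x ^+ 2 + tau x * p x ^+ 2)).
Proof.
move=> [uE pE].
have xE := antiderivative_on_id (R := R) (-1) 0.
have gE := antiderivative_onM xE
  (antiderivative_onD xE (antiderivative_on_cst _ _ 1)).
have := antiderivative_onM (antiderivative_onM gE gE) (antiderivative_onM pE uE).
by move/antiderivative_on_eq; apply => // x _; ring.
Qed.

(** Equipartition: integrated over [[-1, 0]], this bounds the weighted energy by
    a multiple of the integral of [nu * rho * u ^ 2].  The cutoff is the square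
    of [g = x * (x + 1)], so its derivative is dominated by [g] and the cross
    term with [p * u] is absorbed by Young's inequality. *)
Lemma virial_rate nu u p x : n0 <= nu -> -1 < x < 0 ->
  2^-1 * m * (x * (x + 1)) ^+ 2 * amplitude nu u p x <=
  2 * (x * (x + 1)) * (2 * x + 1) * (p x * u x) +
      (x * (x + 1)) ^+ 2 *
        ((q x - nu * rho x) * u x ^+ 2 + tau x * p x ^+ 2)
  + (2 + 2 / (m ^+ 2 * n0)) * nu * rho x * u x ^+ 2.
Proof.
move=> n0nu xI; have [_ _ b1 b2] := weights.
have /b1[/andP[mr _] /andP[mt _]] : -1 <= x <= 0.
  by move/andP: xI => [/ltW -> /ltW ->].
have [_ _ /andP[q0 _]] := b2 _ xI; move/andP: xI => [x1 x0].
have nu0 : 0 < nu by exact: (lt_le_trans n0_gt0 n0nu).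
rewrite /amplitude; set g := x * (x + 1); set h := 2 * x + 1.
have g1 : g ^+ 2 <= 1 by rewrite /g; nra.
have h1 : h ^+ 2 <= 1 by rewrite /h; nra.
have u20 := sqr_ge0 (u x); have p20 := sqr_ge0 (p x); have g20 := sqr_ge0 g.
have gu0 : 0 <= g ^+ 2 * u x ^+ 2 by exact: mulr_ge0.
have gp0 : 0 <= g ^+ 2 * p x ^+ 2 by exact: mulr_ge0.
have mi0 : 0 < m^-1 by rewrite invr_gt0.
have cross : 0 <= 2 * g * h * (p x * u x) + 2^-1 * m * (g ^+ 2 * p x ^+ 2)
                  + 2 / m * u x ^+ 2.
  have s0 := sqr_ge0 (m * g * p x + 2 * h * u x).
  have e1 : 0 <= (1 - h ^+ 2) * u x ^+ 2 by rewrite mulr_ge0// subr_ge0.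
  rewrite (_ : _ + _ = (2 * m)^-1 * ((m * g * p x + 2 * h * u x) ^+ 2 +
     4 * ((1 - h ^+ 2) * u x ^+ 2))).
    apply: mulr_ge0; first by rewrite invr_ge0 ltW// mulr_gt0.
    exact: addr_ge0 s0 (mulr_ge0 (ler0n _ 4) e1).
  by field; rewrite gt_eqF.
have e1 : m * (g ^+ 2 * p x ^+ 2) <= tau x * (g ^+ 2 * p x ^+ 2).
  by rewrite ler_wpM2r.
have e2 : 0 <= q x * (g ^+ 2 * u x ^+ 2) by rewrite mulr_ge0.
have nr0 : 0 <= nu * rho x.
  by rewrite mulr_ge0 ?(ltW nu0)// (le_trans _ mr)// ltW.
have e3 : nu * rho x * (g ^+ 2 * u x ^+ 2) <= nu * rho x * u x ^+ 2.
  by rewrite ler_wpM2l// ler_piMl.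
have e4 : m * (nu * (g ^+ 2 * u x ^+ 2)) <= nu * rho x * u x ^+ 2.
  apply: le_trans e3; rewrite mulrCA -mulrA.
  by apply: ler_wpM2l; [exact: ltW|exact: ler_wpM2r].
have e5 : 2 / m * u x ^+ 2 <= 2 / (m ^+ 2 * n0) * nu * rho x * u x ^+ 2.
  apply: ler_wpM2r => //.
  rewrite (_ : _ * rho x = 2 / m * ((nu / n0) * (rho x / m))); last first.
    by field; rewrite !gt_eqF.
  rewrite ler_peMr//; first by rewrite mulr_ge0// ltW.
  by rewrite -[leLHS]mulr1 ler_pM// ler_pdivlMr// mul1r.
have e6 : 0 <= m * (nu * (g ^+ 2 * u x ^+ 2)).
  by apply: mulr_ge0; [exact: ltW|apply: mulr_ge0 => //; exact: ltW].
rewrite [(2 + _) * nu]mulrDl [(2 * nu + _) * rho x]mulrDl.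
rewrite [(_ + _) * u x ^+ 2]mulrDl.
lra.
Qed.

(** Up to the perturbation, [u * w] is [u ^ 2], whose integral is bounded below
    by [virial_rate]; monotonicity of a suitable combination of the Wronskian,
    the virial function and a polynomial replaces the integration. *)
Lemma wronskian_bound : exists C c, [/\ 0 < C, 0 < c &
  forall nu d u p w pw, n0 <= nu -> 0 < d <= 1 ->
  state rho tau q nu u p -> state rho tau q (nu + d) w pw ->
  w (-1) = u (-1) -> pw (-1) = p (-1) ->
  d * (c - C * d ^+ 2) * amplitude nu u p 0 <=
    nu * (p 0 * w 0 - u 0 * pw 0)].
Proof.
have [C1 C10 cmp] := amplitude_comparable.
have [C2 C20 pert] := perturbation_bound.
set K := 2 + 2 / (m ^+ 2 * n0).
have K0 : 0 < K.
  by rewrite /K addr_gt0// divr_gt0// mulr_gt0// exprn_gt0.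
exists (L * C2 / (2 * n0)), (m / (C1 * 120 * K)).
split; [by rewrite !(divr_gt0, mulr_gt0)|by rewrite !(divr_gt0, mulr_gt0)|].
move=> nu d u p w pw n0nu d01 us ws iu ip; have /andP[d0 d1] := d01.
have nu0 : 0 < nu by exact: (lt_le_trans n0_gt0 n0nu).
have WE := wronskian_antiderivative us ws.
have FE := virial_antiderivative us.
set S0 := amplitude nu u p 0.
set W0 := p 0 * w 0 - u 0 * pw 0.
have xE := antiderivative_on_id (R := R) (-1) 0.
have S00 : 0 <= S0 by apply: amplitude_ge0; exact: ltW.
have HE : antiderivative_on (-1) 0
    (fun x => x ^+ 5 / 5 + x ^+ 4 / 2 + x ^+ 3 / 3 : R)
    (fun x => (x * (x + 1)) ^+ 2).
  have X2 := antiderivative_onM xE xE.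
  have X3 := antiderivative_onM X2 xE.
  have X4 := antiderivative_onM X3 xE.
  have X5 := antiderivative_onM X4 xE.
  have := antiderivative_onD (antiderivative_onD (antiderivative_onZ 5^-1 X5)
    (antiderivative_onZ 2^-1 X4)) (antiderivative_onZ 3^-1 X3).
  move/antiderivative_on_eq; apply => [|x _]; last by field.
  by apply/funext => x; ring.
have rate_ge0 x : -1 < x < 0 -> 0 <=
    2 * (x * (x + 1)) * (2 * x + 1) * (p x * u x) +
    (x * (x + 1)) ^+ 2 * ((q x - nu * rho x) * u x ^+ 2 + tau x * p x ^+ 2) +
    2 * K * nu / d * (d * rho x * u x * w x) +
    - (2^-1 * m * S0 / C1) * (x * (x + 1)) ^+ 2 +
    K * L * C2 * d ^+ 2 * S0 / nu * 1.
  move=> xI; have xI' : -1 <= x <= 0 by move/andP: xI => [/ltW -> /ltW ->].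
  have [_ _ b _] := weights; have [/andP[r1 r2] _] := b _ xI'.
  have r0 : 0 <= rho x by exact/ltW/(lt_le_trans m_gt0).
  have v := virial_rate u p n0nu xI.
  have c : m * (x * (x + 1)) ^+ 2 * (S0 / C1)
      <= m * (x * (x + 1)) ^+ 2 * amplitude nu u p x.
    apply: ler_wpM2l; first by rewrite mulr_ge0 ?sqr_ge0// ltW.
    by rewrite ler_pdivrMr// mulrC; apply: (cmp) => //; rewrite lexx lerN10.
  set f := w x - u x.
  have f2 : nu * f ^+ 2 <= C2 * d ^+ 2 * S0 / nu.
    rewrite ler_pdivlMr// mulrC.
    apply: le_trans (pert _ _ _ _ _ _ _ n0nu d01 us ws iu ip xI').
    by rewrite ler_wpM2l ?(ltW nu0)// /amplitude lerDr sqr_ge0.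
  have f3 : rho x * (nu * f ^+ 2) <= L * (C2 * d ^+ 2 * S0 / nu).
    by apply: ler_pM => //; apply: mulr_ge0 (sqr_ge0 _); exact: ltW.
  have uw : 2^-1 * u x ^+ 2 - 2^-1 * f ^+ 2 <= u x * w x.
    by rewrite /f; have := sqr_ge0 (w x); lra.
  have e : K * nu * rho x * u x ^+ 2 - K * (rho x * (nu * f ^+ 2)) <=
           2 * K * nu / d * (d * rho x * u x * w x).
    have -> : 2 * K * nu / d * (d * rho x * u x * w x)
      = 2 * K * nu * rho x * (u x * w x) by field; rewrite gt_eqF.
    have -> : K * nu * rho x * u x ^+ 2 - K * (rho x * (nu * f ^+ 2)) =
      2 * K * nu * rho x * (2^-1 * u x ^+ 2 - 2^-1 * f ^+ 2) by field.
    apply: ler_wpM2l uw; apply: mulr_ge0 r0; apply: mulr_ge0 (ltW nu0).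
    by apply: mulr_ge0; [exact: ler0n|exact: ltW].
  have f4 := ler_wpM2l (ltW K0) f3.
  rewrite -/K in v; lra.
have n1 : -1 <= (-1 : R) <= 0 by rewrite lexx lerN10.
have main := antiderivative_on_le (antiderivative_onD (antiderivative_onD
  (antiderivative_onD FE (antiderivative_onZ (2 * K * nu / d) WE))
  (antiderivative_onZ (- (2^-1 * m * S0 / C1)) HE))
  (antiderivative_onZ (K * L * C2 * d ^+ 2 * S0 / nu) xE))
  rate_ge0 (lexx _) (lerN10 _) (lexx _).
rewrite /= iu ip -/W0 in main.
have {}main : 2^-1 * m * S0 / C1 / 30 - K * L * C2 * d ^+ 2 * S0 / nu
    <= 2 * K * nu / d * W0 by lra.
have -> : d * (m / (C1 * 120 * K) - L * C2 / (2 * n0) * d ^+ 2) * S0 =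
  d / (2 * K) * (2^-1 * m * S0 / C1 * 30^-1
     - K * L * C2 * d ^+ 2 * S0 / n0).
  by field; rewrite !gt_eqF.
have -> : nu * W0 = d / (2 * K) * (2 * K * nu / d * W0).
  by field; rewrite !gt_eqF.
rewrite ler_wpM2l//; first by rewrite divr_ge0 ?(ltW d0)// mulr_ge0// ltW.
apply: le_trans main.
have dd : K * L * C2 * d ^+ 2 * S0 / nu <= K * L * C2 * d ^+ 2 * S0 / n0.
  apply: ler_wpM2l; last by rewrite lef_pV2.
  apply: mulr_ge0 S00; apply: mulr_ge0 (sqr_ge0 d).
  by rewrite ltW// mulr_gt0// mulr_gt0.
lra.
Qed.

End OneSide.

(** * The algebra of the interface *)

Section Interface.
Context {R : realFieldType}.
Variables (M n0 C c : R).
Hypotheses (M_gt0 : 0 < M) (n0_gt0 : 0 < n0) (C_gt0 : 0 < C) (c_gt0 : 0 < c).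

(** The conclusion of [perturbation_bound] at the interface: [(A, P)] and
    [(w, Q)] stand for the values at [0] of solutions and fluxes for [nu] and
    [nu + d]. *)
Definition shift_close (nu d A P w Q : R) :=
  nu * ((Q - P) ^+ 2 + nu * (w - A) ^+ 2) <= C * d ^+ 2 * (P ^+ 2 + nu * A ^+ 2).

(** The conclusion of [wronskian_bound], in the same notation. *)
Definition wronskian_large (nu d A P w Q : R) :=
  d * (c - C * d ^+ 2) * (P ^+ 2 + nu * A ^+ 2) <= nu * (P * w - A * Q).

Lemma mul_le_of_sqr_le (x y : R) : x ^+ 2 <= y ^+ 2 / 16 ->
  - (y ^+ 2 / 4) <= x * y <= y ^+ 2 / 4.
Proof.
have := sqr_ge0 (4 * x - y); have := sqr_ge0 (4 * x + y) => h1 h2 h.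
by apply/andP; split; lra.
Qed.

(** The ratio [r] is [k2 / k1].  The interface conditions make the first
    Wronskian plus [r] times the second equal to [- d * M * (A * w1)], and
    [- A * w1 <= (w1 - A) ^ 2] is of order [d ^ 2 / nu ^ 2]. *)
Lemma interface_same_sign (nu d A P1 P2 Q1 Q2 w1 w2 r : R) :
  n0 <= nu -> 0 < d -> C * d ^+ 2 <= c / 2 -> M * (C * d ^+ 2) < n0 * (c / 2) ->
  0 < r -> w1 = r * w2 ->
  P1 + P2 = nu * M * A -> Q1 + r * Q2 = (nu + d) * M * w1 ->
  0 < P1 ^+ 2 + nu * A ^+ 2 -> 
  shift_close nu d A P1 w1 Q1 ->
  wronskian_large nu d A P1 w1 Q1 -> wronskian_large nu d A P2 w2 Q2 ->
  False.
Proof.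
rewrite /shift_close /wronskian_large => n0nu d0 d1 d2 r0 wE PE QE S10 cl1 W1 W2.
have nu0 : 0 < nu by exact: (lt_le_trans n0_gt0 n0nu).
set S1 := P1 ^+ 2 + nu * A ^+ 2 in S10 cl1 W1.
have S20 : 0 <= P2 ^+ 2 + nu * A ^+ 2.
  by rewrite addr_ge0 ?sqr_ge0// mulr_ge0 ?sqr_ge0 ?ltW.
have c2 : c / 2 <= c - C * d ^+ 2 by lra.
have W20 : 0 <= nu * (P2 * w2 - A * Q2).
  apply: le_trans W2; apply: mulr_ge0 S20; apply: mulr_ge0; first exact: ltW.
  by apply: le_trans c2; rewrite divr_ge0// ltW.
have W1' : d * (c / 2) * S1 <= nu * (P1 * w1 - A * Q1).
  apply: le_trans W1; apply: ler_wpM2r (ltW S10) _ _ _.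
  by rewrite ler_wpM2l// ltW.
have sumW : (P1 * w1 - A * Q1) + r * (P2 * w2 - A * Q2) = - d * M * (A * w1).
  have -> : P2 = nu * M * A - P1 by rewrite -PE; ring.
  have -> : Q1 = (nu + d) * M * w1 - r * Q2 by rewrite -QE; ring.
  by rewrite wE; ring.
have h1 : d * (c / 2) * S1 <= d * (M * (nu * (w1 - A) ^+ 2)).
  apply: (le_trans W1'); apply: (@le_trans _ _ (nu * (- d * M * (A * w1)))).
    rewrite -sumW [leRHS]mulrDr lerDl mulrCA; apply: mulr_ge0 W20.
    exact: ltW.
  have dMnu : 0 <= d * M * nu by rewrite ltW// !mulr_gt0.
  have := sqr_ge0 w1; have := sqr_ge0 A => a2 w2'.
  have {a2 w2'} h : - (A * w1) <= (w1 - A) ^+ 2.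
    have := sqr_ge0 (w1 - 2^-1 * A); lra.
  by have := ler_wpM2l dMnu h; lra.
have {}h1 : c / 2 * S1 <= M * (nu * (w1 - A) ^+ 2).
  by rewrite -(ler_pM2l d0); lra.
have h2 : nu * (nu * (w1 - A) ^+ 2) <= C * d ^+ 2 * S1.
  apply: le_trans cl1; rewrite ler_pM2l// lerDr; exact: sqr_ge0.
have : n0 * (c / 2) * S1 < n0 * (c / 2) * S1.
  apply: (@le_lt_trans _ _ (M * (C * d ^+ 2) * S1)); last by rewrite ltr_pM2r.
  have a1 := ler_wpM2l (ltW M_gt0) h2; have a2 := ler_wpM2l (ltW nu0) h1.
  have a3 : 0 <= c / 2 * S1 by rewrite mulr_ge0 ?(ltW S10)// divr_ge0// ltW.
  have := ler_wpM2r a3 n0nu; lra.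
by rewrite ltxx.
Qed.

(** The ratio [r] is [- k2 / k1].  Since [A * w1 <= 0], [|A|] and [|w1|] are
    at most [|w1 - A|], so [P1] and [Q1] dominate and agree in sign.  The
    interface conditions then force [P2] and [Q2] to have opposite signs. *)
Lemma interface_opposite_sign (nu d A P1 P2 Q1 Q2 w1 r : R) :
  n0 <= nu -> 0 < d -> d <= n0 ->
  32 * (C * d ^+ 2) <= n0 -> 128 * (M ^+ 2 * (C * d ^+ 2)) <= 1 ->
  0 < r -> A * w1 <= 0 ->
  P1 + P2 = nu * M * A -> Q1 - r * Q2 = (nu + d) * M * w1 ->
  0 < P1 ^+ 2 + nu * A ^+ 2 ->
  shift_close nu d A P1 w1 Q1 -> shift_close nu d A P2 (w1 / - r) Q2 ->
  False.
Proof.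
rewrite /shift_close => n0nu d0 dn0 d1 d2 r0 Aw PE QE S10 cl1 cl2.
have nu0 : 0 < nu by exact: (lt_le_trans n0_gt0 n0nu).
have e0 : 0 <= C * d ^+ 2 by rewrite mulr_ge0 ?sqr_ge0// ltW.
set e := C * d ^+ 2 in d1 d2 e0 cl1 cl2.
set S1 := P1 ^+ 2 + nu * A ^+ 2 in S10 cl1.
have e32 : 32 * e <= nu by lra.
have A2 := sqr_ge0 A; have w2 := sqr_ge0 w1; have PP := sqr_ge0 P1.
have cl1' : nu * (nu * (A ^+ 2 + w1 ^+ 2)) <= e * S1.
  apply: le_trans cl1; rewrite ler_pM2l//.
  apply: (@le_trans _ _ (nu * (w1 - A) ^+ 2)); last by rewrite lerDr sqr_ge0.
  by rewrite ler_pM2l//; lra.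
have clQ : nu * (Q1 - P1) ^+ 2 <= e * S1.
  by apply: le_trans cl1; rewrite ler_pM2l// lerDl mulr_ge0 ?sqr_ge0// ltW.
have eS : e * S1 <= nu * (S1 / 32).
  by rewrite mulrA ler_pdivlMr// mulrAC ler_pM2r// mulrC.
have nA : nu * (A ^+ 2 + w1 ^+ 2) <= S1 / 32.
  by rewrite -(ler_pM2l nu0); exact: le_trans eS.
have nA' : 0 <= nu * w1 ^+ 2 by rewrite mulr_ge0// ltW.
have SP : S1 <= 2 * P1 ^+ 2 by rewrite /S1 in nA *; lra.
have P10 : 0 < P1 ^+ 2 by lra.
have nn : nu * (nu * (A ^+ 2 + w1 ^+ 2)) <= 2 * e * P1 ^+ 2.
  by have := ler_wpM2l e0 SP; lra.
have M2 : 0 <= M ^+ 2 by exact: sqr_ge0.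
have big : M ^+ 2 * (nu * (nu * (A ^+ 2 + w1 ^+ 2))) <= P1 ^+ 2 / 64.
  apply: le_trans (ler_wpM2l M2 nn) _.
  by have := ler_wpM2r (ltW P10) d2; lra.
have sX : (nu * M * A) ^+ 2 <= P1 ^+ 2 / 16.
  have : 0 <= M ^+ 2 * (nu * (nu * w1 ^+ 2)).
    by apply: mulr_ge0 => //; apply: mulr_ge0 => //; exact: ltW.
  lra.
have sZ : ((nu + d) * M * w1) ^+ 2 <= P1 ^+ 2 / 16.
  have h0 : 0 <= M ^+ 2 * (nu * (nu * A ^+ 2)).
    by do 3?[apply: mulr_ge0 => //; try exact: ltW].
  have h1 : (nu + d) ^+ 2 <= (2 * nu) ^+ 2.
    by rewrite lerXn2r ?nnegrE//; lra.
  have := ler_wpM2r (mulr_ge0 M2 w2) h1; lra.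
have sY : (Q1 - P1) ^+ 2 <= P1 ^+ 2 / 16.
  rewrite -(ler_pM2l nu0); apply: (le_trans clQ); apply: (le_trans eS).
  by rewrite ler_pM2l//; lra.
have /andP[X1 X2] := mul_le_of_sqr_le sX.
have /andP[Z1 Z2] := mul_le_of_sqr_le sZ.
have /andP[Y1 Y2] := mul_le_of_sqr_le sY.
have P2E : P2 = nu * M * A - P1 by rewrite -PE; ring.
have PP2 : P1 * P2 < 0 by rewrite P2E; lra.
have P2P1 : P1 ^+ 2 / 2 <= P2 ^+ 2.
  by rewrite P2E sqrrB; have := sqr_ge0 (nu * M * A); lra.
have rQ : 0 < P1 * (r * Q2).
  have -> : r * Q2 = Q1 - (nu + d) * M * w1 by rewrite -QE; ring.
  lra.
have PQ : P2 * Q2 < 0.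
  have : (P1 * P2) * (P1 * (r * Q2)) < 0 by rewrite nmulr_rlt0.
  rewrite (_ : _ * _ = r * P1 ^+ 2 * (P2 * Q2)); last by ring.
  by rewrite pmulr_rlt0// mulr_gt0.
have : nu * (Q2 - P2) ^+ 2 <= e * (P2 ^+ 2 + nu * A ^+ 2).
  by apply: le_trans cl2; rewrite ler_pM2l// lerDl mulr_ge0 ?sqr_ge0// ltW.
have : nu * P2 ^+ 2 < nu * (Q2 - P2) ^+ 2.
  by rewrite ltr_pM2l//; have := sqr_ge0 Q2; lra.
have : e * (P2 ^+ 2 + nu * A ^+ 2) <= nu / 32 * (2 * P2 ^+ 2).
  apply: ler_pM => //; [|lra|lra].
  by rewrite addr_ge0 ?sqr_ge0// mulr_ge0// ltW.
have := mulr_gt0 nu0 P10; have := ler_wpM2l (ltW nu0) P2P1.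
lra.
Qed.

(** When [k1] and [k2] have opposite signs, so do [w1] and [w2], hence
    [A * w1 <= 0] or [A * w2 <= 0]; in the second case the two sides are
    exchanged. *)
Lemma interface_gap : exists2 d0, 0 < d0 <= 1 &
  forall nu d A P1 P2 Q1 Q2 w1 w2 k1 k2, n0 <= nu -> 0 < d -> d <= d0 ->
  k1 != 0 -> k2 != 0 -> k1 * w1 = k2 * w2 ->
  P1 + P2 = nu * M * A -> k1 * Q1 + k2 * Q2 = (nu + d) * M * (k1 * w1) ->
  0 < P1 ^+ 2 + nu * A ^+ 2 -> 0 < P2 ^+ 2 + nu * A ^+ 2 ->
  shift_close nu d A P1 w1 Q1 -> shift_close nu d A P2 w2 Q2 ->
  wronskian_large nu d A P1 w1 Q1 -> wronskian_large nu d A P2 w2 Q2 ->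
  False.
Proof.
(* A number above the inverses of all the smallness thresholds. *)
pose big := 1 + n0^-1 + C * (2 / c) + C * M * (4 / (n0 * c)) + 32 * C / n0
            + 128 * M ^+ 2 * C.
have t1 : 0 < n0^-1 by rewrite invr_gt0.
have t2 : 0 < C * (2 / c) by rewrite !(mulr_gt0, invr_gt0).
have t3 : 0 < C * M * (4 / (n0 * c)) by rewrite !(mulr_gt0, invr_gt0).
have t4 : 0 < 32 * C / n0 by rewrite !(mulr_gt0, invr_gt0).
have t5 : 0 < 128 * M ^+ 2 * C by rewrite !(mulr_gt0, invr_gt0).
have big1 : 1 <= big by rewrite /big; lra.
have big0 : 0 < big by lra.
exists big^-1; first by rewrite invr_gt0 big0 invf_le1.
move=> nu d A P1 P2 Q1 Q2 w1 w2 k1 k2 n0nu d0 dle k10 k20 wE PE QE S1 S2.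
move=> cl1 cl2 W1 W2.
have bd : d * big <= 1 by rewrite -ler_pdivlMr// mul1r.
have d1 : d <= 1 by rewrite (le_trans dle)// invf_le1.
have small x : 0 < x -> x <= big -> d ^+ 2 * x <= 1.
  move=> x0 xb; apply: le_trans bd; apply: ler_pM => //; first exact: sqr_ge0.
    exact: ltW.
  by rewrite expr2 ger_pMl.
have s1 : d <= n0.
  rewrite -[leRHS]mul1r -ler_pdivrMr//.
  by apply: le_trans bd; rewrite ler_pM2l// /big; lra.
have s2 : C * d ^+ 2 <= c / 2.
  rewrite -[leRHS]mul1r -ler_pdivrMr ?divr_gt0//.
  have -> : C * d ^+ 2 / (c / 2) = d ^+ 2 * (C * (2 / c)).
    by field; rewrite gt_eqF.
  by apply: small => //; rewrite /big; lra.
have s3 : M * (C * d ^+ 2) < n0 * (c / 2).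
  apply: (@le_lt_trans _ _ (n0 * (c / 4))).
    rewrite -[leRHS]mul1r -ler_pdivrMr; last first.
      by rewrite mulr_gt0// divr_gt0.
    have -> : M * (C * d ^+ 2) / (n0 * (c / 4)) =
              d ^+ 2 * (C * M * (4 / (n0 * c))).
      by field; rewrite !gt_eqF.
    by apply: small => //; rewrite /big; lra.
  by have := mulr_gt0 n0_gt0 c_gt0; lra.
have s4 : 32 * (C * d ^+ 2) <= n0.
  rewrite -[leRHS]mul1r -ler_pdivrMr//.
  have -> : 32 * (C * d ^+ 2) / n0 = d ^+ 2 * (32 * C / n0) by ring.
  by apply: small => //; rewrite /big; lra.
have s5 : 128 * (M ^+ 2 * (C * d ^+ 2)) <= 1.
  have -> : 128 * (M ^+ 2 * (C * d ^+ 2)) = d ^+ 2 * (128 * M ^+ 2 * C) by ring.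
  by apply: small => //; rewrite /big; lra.
have w1E : w1 = k2 / k1 * w2.
  by rewrite mulrAC -wE mulrC mulKf.
have QE' : Q1 + k2 / k1 * Q2 = (nu + d) * M * w1.
  have -> : Q1 + k2 / k1 * Q2 = (k1 * Q1 + k2 * Q2) / k1 by field.
  by rewrite QE; field.
have [r0|r0|/esym/eqP] := ltgtP 0 (k2 / k1).
- exact: (interface_same_sign n0nu d0 s2 s3 r0 w1E PE QE' S1 cl1 W1 W2).
- pose r := - (k2 / k1); have rp : 0 < r by rewrite oppr_gt0.
  have w2E : w2 = w1 / - r.
    by rewrite /r opprK w1E mulrC mulKf// mulf_neq0// invr_eq0.
  have [Aw|Aw] := leP (A * w1) 0.
    apply: (interface_opposite_sign n0nu d0 s1 s4 s5 rp Aw PE _ S1 cl1 _).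
      by rewrite -QE' /r mulNr opprK.
    by rewrite -w2E.
  have r'p : 0 < r^-1 by rewrite invr_gt0.
  have Aw2 : A * w2 <= 0.
    by rewrite w2E mulrA invrN mulrN oppr_le0 mulr_ge0// ltW.
  have PE' : P2 + P1 = nu * M * A by rewrite addrC.
  have QE'' : Q2 - r^-1 * Q1 = (nu + d) * M * w2.
    apply: (mulfI (lt0r_neq0 rp)).
    rewrite mulrBr mulVKf ?lt0r_neq0//.
    have -> : r * ((nu + d) * M * w2) = (nu + d) * M * (r * w2) by ring.
    have -> : r * w2 = - w1 by rewrite w1E /r mulNr.
    by rewrite mulrN -QE' /r mulNr opprD addrC.
  apply: (interface_opposite_sign n0nu d0 s1 s4 s5 r'p Aw2 PE' QE'' S2 cl2 _).
  have -> : w2 / - r^-1 = w1; last exact: cl1.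
  by rewrite invrN invrK w1E /r opprK mulrC.
- by rewrite mulf_eq0 invr_eq0 (negPf k10) (negPf k20).
Qed.

End Interface.

(** * Reflection, inversion and bounds of the coefficients *)

Section Coefficients.
Context {R : realType}.
Implicit Types (f df : R -> R) (a b : R).

Lemma continuous_within_opp a b f : a < b ->
  {within `[a, b], continuous f} ->
  {within `[- b, - a], continuous (fun x => f (- x))}.
Proof.
move=> ab /(continuous_within_itvP _ ab)[co ca cb].
apply/continuous_within_itvP; first by rewrite ltrN2.
split.
- move=> x; rewrite in_itv/= => /andP[bx xa].
  apply: (@continuous_comp _ _ _ (fun x : R => - x) f); first exact: continuousN.
  by apply: co; rewrite in_itv/= ltrNr xa ltrNl.
- by apply/cvg_at_leftNP; rewrite opprK.
- by apply/cvg_at_rightNP; rewrite opprK.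
Qed.

Lemma antiderivative_on_opp a b f df : a < b -> antiderivative_on a b f df ->
  antiderivative_on (- b) (- a) (fun x => f (- x)) (fun x => - df (- x)).
Proof.
move=> ab [cf f']; split; first exact: continuous_within_opp.
move=> x /andP[bx xa].
have xab : a < - x < b by rewrite ltrNr xa ltrNl.
have fx := f' _ xab.
have Nx : is_derive x 1 (fun y : R => - y) (- 1).
  exact: is_deriveN.
apply: (is_derive_eq (@is_derive1_comp _ f (fun y : R => - y) x _ _ fx Nx)).
by rewrite mulrN1.
Qed.

(** The values of [f] outside [[a, b]] are arbitrary, possibly zero, hence the
    passage through interior and one-sided limits. *)
Lemma antiderivative_onV a b f df : a < b -> antiderivative_on a b f df ->
  (forall x, a <= x <= b -> f x != 0) ->
  antiderivative_on a b (fun x => (f x)^-1) (fun x => - (df x * (f x)^-1 ^+ 2)).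
Proof.
move=> ab [cf f'] f0; split=> [|x xab].
- have /(continuous_within_itvP _ ab)[co ca cb] := cf.
  apply/continuous_within_itvP => //; split.
  + move=> x; rewrite in_itv/= => /andP[ax xb]; apply: cvgV.
      by apply: f0; rewrite !ltW.
    by apply: co; rewrite in_itv/= ax.
  + by apply: cvgV => //; apply: f0; rewrite lexx ltW.
  + by apply: cvgV => //; apply: f0; rewrite lexx ltW.
- have fx := f' x xab; have fx0 : f x != 0.
    by apply: f0; move: xab => /andP[ax xb]; rewrite !ltW.
  apply: (is_derive_eq (is_deriveV fx0 fx)).
  by rewrite /GRing.scale/= mulNr mulrC exprVn.
Qed.

Lemma weights_bounded_exist (rho drho sigma dsigma q : R -> R) (A c : R) :
  antiderivative_on (-1) 0 rho drho -> antiderivative_on (-1) 0 sigma dsigma ->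
  {within `[-1, 0], continuous q} -> 0 < c ->
  (forall x, -1 <= x <= 0 -> [/\ c <= rho x, c <= sigma x & 0 <= q x]) ->
  (forall x, -1 < x < 0 -> `|drho x| <= A /\ `|dsigma x| <= A) ->
  exists m L dtau, 0 < m /\
    weights_bounded m L rho drho (fun x => (sigma x)^-1) dtau q.
Proof.
move=> rE sE cq c0 pos bd; have N10 : -1 < (0 : R) by rewrite ltrN10.
have [cr _] := rE; have [cs _] := sE.
have [Br rB] := continuous_itv_bounded N10 cr.
have [Bs sB] := continuous_itv_bounded N10 cs.
have [Bq qB] := continuous_itv_bounded N10 cq.
have x0 : -1 <= (0 : R) <= 0 by rewrite lexx lerN10.
have xh : -1 < (- 2^-1 : R) < 0 by apply/andP; split; lra.
have A0 : 0 <= A by have [h _] := bd _ xh; exact: le_trans h.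
have Br0 : 0 <= Br by exact: le_trans (rB _ x0).
have Bs0 : 0 <= Bs by exact: le_trans (sB _ x0).
have Bq0 : 0 <= Bq by exact: le_trans (qB _ x0).
have ci0 : 0 < c^-1 by rewrite invr_gt0.
have s_neq0 x : -1 <= x <= 0 -> sigma x != 0.
  by move=> /pos[_ sx _]; rewrite gt_eqF// (lt_le_trans c0).
have tE := antiderivative_onV N10 sE s_neq0.
have Ac0 : 0 <= A * c^-1 ^+ 2 by rewrite mulr_ge0// sqr_ge0.
pose m := Num.min c (Bs + 1)^-1.
have Bsi0 : 0 < (Bs + 1)^-1 by rewrite invr_gt0; lra.
pose L := Br + Bq + c^-1 + A + A * c^-1 ^+ 2.
exists m, L; eexists; split; last split; [|exact: rE|exact: tE| |].
- by rewrite lt_min c0.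
- move=> x xI; have [rx sx _] := pos x xI.
  have sx0 : 0 < sigma x by apply: lt_le_trans sx.
  have := rB x xI; have := sB x xI => h1 h2.
  split; apply/andP; split.
  + by apply: le_trans rx; rewrite ge_min lexx.
  + by have := ler_norm (rho x); rewrite /L; lra.
  + apply: (@le_trans _ _ (Bs + 1)^-1); first by rewrite ge_min lexx orbT.
    rewrite lef_pV2 ?posrE//; last by lra.
    by have := ler_norm (sigma x); lra.
  + apply: (@le_trans _ _ c^-1); first by rewrite lef_pV2 ?posrE.
    by rewrite /L; lra.
- move=> x /[dup] /bd[dr ds] /andP[x1 x2].
  have xI : -1 <= x <= 0 by rewrite !ltW.
  have [rx sx qx] := pos x xI; have := qB x xI => h1.
  have sx0 : 0 < sigma x by apply: lt_le_trans sx.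
  split.
  + by rewrite /L; lra.
  + rewrite normrN normrM.
    apply: (@le_trans _ _ (A * c^-1 ^+ 2)); last by rewrite /L; lra.
    apply: ler_pM => //; rewrite ger0_norm ?sqr_ge0//.
    by rewrite lerXn2r ?nnegrE ?invr_ge0 ?(ltW c0) ?(ltW sx0)// lef_pV2 ?posrE.
  + rewrite qx; have := ler_norm (q x); rewrite /L; lra.
Qed.

End Coefficients.

Section Assembly.
Context {R : realType}.

Lemma SL_state (a b : R) (rho sigma q : R -> R) (nu : R) (u u' : R -> R) :
  a < b -> {within `[a, b], continuous sigma} ->
  (forall x, a <= x <= b -> 0 < sigma x) ->
  C1_with_derivative a b u u' -> SL_equation a b rho sigma q nu u u' ->
  antiderivative_on a b u (fun x => (sigma x)^-1 * (sigma x * u' x)) /\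
  antiderivative_on a b (fun x => sigma x * u' x)
    (fun x => (q x - nu * rho x) * u x).
Proof.
move=> ab cs s0 [cu cu' uu'] eq; split; split.
- exact: cu.
- move=> x xab; rewrite mulKf; last first.
    by rewrite gt_eqF// s0//; move/andP: xab => [/ltW -> /ltW ->].
  by apply: uu'; rewrite inE/= in_itv.
- by move=> x; exact: continuousM (cs x) (cu' x).
- move=> x xab; have [dp e] : derivable (fun y => sigma y * u' y) x 1 /\
    - (fun y => sigma y * u' y)^`()%classic x + q x * u x = nu * rho x * u x.
    by apply: eq; rewrite inE/= in_itv.
  have -> : (q x - nu * rho x) * u x = (fun y => sigma y * u' y)^`()%classic x.
    by rewrite mulrBl -e; ring.
  by rewrite derive1E; exact/derivableP.
Qed.

End Assembly.

(** * Eigenfunctions and the gap *)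

(** Index [2] refers to the right side reflected onto [[-1, 0]], which turns the
    jump of the fluxes into a sum. *)
Definition coupled_state {R : realType} (M : R)
    (rho1 tau1 q1 rho2 tau2 q2 : R -> R) (nu : R) (f1 p1 f2 p2 : R -> R) :=
  [/\ state rho1 tau1 q1 nu f1 p1, state rho2 tau2 q2 nu f2 p2,
      f1 (-1) = 0 /\ p2 (-1) = 0 &
      f1 0 = f2 0 /\ p1 0 + p2 0 = nu * M * f1 0].

Definition nontrivial {R : realType} (f1 f2 : R -> R) :=
  exists2 x, -1 <= x <= 0 & f1 x != 0 \/ f2 x != 0.

Section CoupledGap.
Context {R : realType}.

Lemma stateZ (rho tau q : R -> R) (nu k : R) (f p : R -> R) :
  state rho tau q nu f p ->
  state rho tau q nu (fun x => k * f x) (fun x => k * p x).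
Proof.
move=> [fE pE]; split.
- have := antiderivative_onZ k fE.
  by move/antiderivative_on_eq; apply => // x _; ring.
- have := antiderivative_onZ k pE.
  by move/antiderivative_on_eq; apply => // x _; ring.
Qed.

Lemma amplitude_gt0 (nu : R) (f p : R -> R) (x : R) : 0 < nu ->
  f x != 0 \/ p x != 0 -> 0 < amplitude nu f p x.
Proof.
have pos (r : R) : r != 0 -> 0 < r ^+ 2 by rewrite exprn_even_gt0.
move=> nu0 [fx|px]; rewrite /amplitude.
- by apply: ltr_wpDl; [exact: sqr_ge0|rewrite mulr_gt0// pos].
- by apply: ltr_pwDl; [exact: pos|apply: mulr_ge0; [exact: ltW|exact: sqr_ge0]].
Qed.

Lemma side_estimates (m L n0 : R) (rho drho tau dtau q : R -> R) :
  0 < m -> 0 < n0 -> weights_bounded m L rho drho tau dtau q ->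
  exists C c, [/\ 0 < C, 0 < c &
  forall nu d u p w pw, n0 <= nu -> 0 < d <= 1 ->
  state rho tau q nu u p -> state rho tau q (nu + d) w pw ->
  w (-1) = u (-1) -> pw (-1) = p (-1) ->
  shift_close C nu d (u 0) (p 0) (w 0) (pw 0) /\
  wronskian_large C c nu d (u 0) (p 0) (w 0) (pw 0)].
Proof.
move=> m0 n00 wb.
have [C1 C10 pert] := perturbation_bound m0 n00 wb.
have [C2 [c [C20 c0 wron]]] := wronskian_bound m0 n00 wb.
exists (C1 + C2), c; split=> [||nu d u p w pw n0nu d01 us ws iu ip] //.
  by rewrite addr_gt0.
have nu0 : 0 <= nu by exact/ltW/(lt_le_trans n00).
have S0 := amplitude_ge0 u p 0 nu0.
have d2 := sqr_ge0 d.
have z01 : -1 <= (0 : R) <= 0 by rewrite lexx lerN10.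
have /andP[/ltW d0 _] := d01.
split.
- apply: le_trans (pert _ _ _ _ _ _ _ n0nu d01 us ws iu ip z01) _.
  by rewrite ler_wpM2r// ler_wpM2r// lerDl ltW.
- apply: le_trans (wron _ _ _ _ _ _ n0nu d01 us ws iu ip).
  rewrite ler_wpM2r// ler_wpM2l// lerD2l lerN2 ler_wpM2r//.
  by rewrite lerDr ltW.
Qed.

Lemma shift_close_le (C C' nu d A P w Q : R) : 0 <= nu -> C <= C' ->
  shift_close C nu d A P w Q -> shift_close C' nu d A P w Q.
Proof.
move=> nu0 CC; rewrite /shift_close => h; apply: (le_trans h).
rewrite ler_wpM2r ?ler_wpM2r ?sqr_ge0// addr_ge0 ?sqr_ge0//.
by rewrite mulr_ge0 ?sqr_ge0.
Qed.

Lemma wronskian_large_le (C C' c c' nu d A P w Q : R) :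
  0 <= nu -> 0 <= d -> C <= C' -> c' <= c ->
  wronskian_large C c nu d A P w Q -> wronskian_large C' c' nu d A P w Q.
Proof.
move=> nu0 d0 CC cc; rewrite /wronskian_large; apply: le_trans.
have S0 : 0 <= P ^+ 2 + nu * A ^+ 2.
  by rewrite addr_ge0 ?sqr_ge0// mulr_ge0 ?sqr_ge0.
by rewrite ler_wpM2r// ler_wpM2l// lerB// ler_wpM2r// sqr_ge0.
Qed.

Variables (M n0 m1 L1 m2 L2 : R).
Variables (rho1 drho1 tau1 dtau1 q1 rho2 drho2 tau2 dtau2 q2 : R -> R).
Hypotheses (M_gt0 : 0 < M) (n0_gt0 : 0 < n0) (m1_gt0 : 0 < m1) (m2_gt0 : 0 < m2).
Hypothesis weights1 : weights_bounded m1 L1 rho1 drho1 tau1 dtau1 q1.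
Hypothesis weights2 : weights_bounded m2 L2 rho2 drho2 tau2 dtau2 q2.

Let coupled := coupled_state M rho1 tau1 q1 rho2 tau2 q2.

(** Uniqueness for the initial value problem, from any starting point. *)
Lemma state_eq0 (m L : R) (rho drho tau dtau q : R -> R) (nu x y : R)
    (f p : R -> R) :
  0 < m -> weights_bounded m L rho drho tau dtau q -> n0 <= nu ->
  state rho tau q nu f p -> -1 <= x <= 0 -> f x = 0 -> p x = 0 ->
  -1 <= y <= 0 -> f y = 0 /\ p y = 0.
Proof.
move=> m0 wb n0nu fs x01 fx px y01.
have [C _ cmp] := amplitude_comparable m0 n0_gt0 wb.
have nu0 : 0 < nu by exact: lt_le_trans n0nu.
have : amplitude nu f p y <= 0.
  apply: (le_trans (cmp _ _ _ _ _ n0nu fs y01 x01)).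
  by rewrite /amplitude fx px expr0n/= mulr0 addr0 mulr0.
by move=> h; split; apply/eqP; apply/negPn/negP => h0;
  move: h; apply/negP; rewrite -ltNge; apply: amplitude_gt0 => //; [left|right].
Qed.

(** A solution that vanishes identically on one side has zero Cauchy data at the
    interface on the other side, by the interface conditions. *)
Lemma coupled_initial_neq0 (nu : R) (f1 p1 f2 p2 : R -> R) :
  n0 <= nu -> coupled nu f1 p1 f2 p2 -> nontrivial f1 f2 ->
  p1 (-1) != 0 /\ f2 (-1) != 0.
Proof.
move=> n0nu [s1 s2 [f10 p20] [f120 p120]] [x x01 fx].
have z01 : -1 <= (0 : R) <= 0 by rewrite lexx lerN10.
have n01 : -1 <= (-1 : R) <= 0 by rewrite lexx lerN10.
split; apply/eqP => i0.
- have E1 y := state_eq0 m1_gt0 weights1 n0nu s1 n01 f10 i0 (y := y).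
  have [a0 P0] := E1 _ z01.
  have f20 : f2 0 = 0 by rewrite -f120.
  have p20' : p2 0 = 0 by move: p120; rewrite P0 a0 add0r mulr0.
  have [f2x _] := state_eq0 m2_gt0 weights2 n0nu s2 z01 f20 p20' x01.
  have [f1x _] := E1 _ x01.
  by case: fx; rewrite ?f1x ?f2x eqxx.
- have E2 y := state_eq0 m2_gt0 weights2 n0nu s2 n01 i0 p20 (y := y).
  have [a0 P0] := E2 _ z01.
  have f10' : f1 0 = 0 by rewrite f120.
  have p10' : p1 0 = 0 by move: p120; rewrite P0 f10' addr0 mulr0.
  have [f1x _] := state_eq0 m1_gt0 weights1 n0nu s1 z01 f10' p10' x01.
  have [f2x _] := E2 _ x01.
  by case: fx; rewrite ?f1x ?f2x eqxx.
Qed.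

(** The initial data on each side lie in a line, so dividing the second
    eigenfunction by [k1] and [k2] gives both eigenfunctions the same initial
    data; this is the setting of the one-sided estimates. *)
Lemma coupled_gap : exists2 d0, 0 < d0 & forall nu d f1 p1 f2 p2 g1 r1 g2 r2,
  n0 <= nu -> 0 < d -> d <= d0 ->
  coupled nu f1 p1 f2 p2 -> nontrivial f1 f2 ->
  coupled (nu + d) g1 r1 g2 r2 -> nontrivial g1 g2 -> False.
Proof.
have [C1 [c1 [C10 c10 est1]]] := side_estimates m1_gt0 n0_gt0 weights1.
have [C2 [c2 [C20 c20 est2]]] := side_estimates m2_gt0 n0_gt0 weights2.
pose C := C1 + C2; pose c := Num.min c1 c2.
have C0 : 0 < C by rewrite addr_gt0.
have c0 : 0 < c by rewrite lt_min c10.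
have [d0 /andP[d00 d01] gap] := interface_gap M_gt0 n0_gt0 C0 c0.
exists d0 => // nu d f1 p1 f2 p2 g1 r1 g2 r2 n0nu dgt0 dle fs fn gs gn.
have nu0 : 0 < nu by exact: (lt_le_trans n0_gt0).
have n0nud : n0 <= nu + d by rewrite (le_trans n0nu)// lerDl ltW.
have [ip1 if2] := coupled_initial_neq0 n0nu fs fn.
have [ir1 ig2] := coupled_initial_neq0 n0nud gs gn.
have [s1 s2 [f1i p2i] [f0 p0]] := fs.
have [t1 t2 [g1i r2i] [g0 r0]] := gs.
have dI : 0 < d <= 1 by rewrite dgt0 (le_trans dle).
have z01 : -1 <= (0 : R) <= 0 by rewrite lexx lerN10.
have n01 : -1 <= (-1 : R) <= 0 by rewrite lexx lerN10.
pose k1 := r1 (-1) / p1 (-1); pose k2 := g2 (-1) / f2 (-1).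
have k10 : k1 != 0 by rewrite mulf_neq0// invr_neq0.
have k20 : k2 != 0 by rewrite mulf_neq0// invr_neq0.
have i1 : k1^-1 * r1 (-1) = p1 (-1).
  by rewrite /k1 invf_div divfK.
have i2 : k2^-1 * g2 (-1) = f2 (-1).
  by rewrite /k2 invf_div divfK.
have j1 : k1^-1 * g1 (-1) = f1 (-1) by rewrite g1i f1i mulr0.
have j2 : k2^-1 * r2 (-1) = p2 (-1) by rewrite r2i p2i mulr0.
have [sc1 wl1] := est1 _ _ _ _ _ _ n0nu dI s1 (stateZ k1^-1 t1) j1 i1.
have [sc2 wl2] := est2 _ _ _ _ _ _ n0nu dI s2 (stateZ k2^-1 t2) i2 j2.
have CC1 : C1 <= C by rewrite lerDl ltW.
have CC2 : C2 <= C by rewrite lerDr ltW.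
have cc1 : c <= c1 by rewrite ge_min lexx.
have cc2 : c <= c2 by rewrite ge_min lexx orbT.
have S1 : 0 < amplitude nu f1 p1 0.
  have [D D0 cmp] := amplitude_comparable m1_gt0 n0_gt0 weights1.
  rewrite -(pmulr_rgt0 _ D0); apply: lt_le_trans (cmp _ _ _ _ _ n0nu s1 n01 z01).
  by apply: amplitude_gt0 => //; right.
have S2 : 0 < amplitude nu f2 p2 0.
  have [D D0 cmp] := amplitude_comparable m2_gt0 n0_gt0 weights2.
  rewrite -(pmulr_rgt0 _ D0); apply: lt_le_trans (cmp _ _ _ _ _ n0nu s2 n01 z01).
  by apply: amplitude_gt0 => //; left.
rewrite /amplitude -f0 in S2; rewrite -f0 in sc2 wl2.
apply: (gap nu d (f1 0) (p1 0) (p2 0) (k1^-1 * r1 0) (k2^-1 * r2 0)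
  (k1^-1 * g1 0) (k2^-1 * g2 0) k1 k2) => //.
- by rewrite !mulVKf.
- by rewrite !mulVKf.
- apply: shift_close_le CC1 sc1; exact: ltW.
- apply: shift_close_le CC2 sc2; exact: ltW.
- apply: wronskian_large_le CC1 cc1 wl1; exact: ltW.
- apply: wronskian_large_le CC2 cc2 wl2; exact: ltW.
Qed.

End CoupledGap.

Section Eigenvalue.
Context {R : realType}.
Variables (M : R) (rho1 sigma1 q1 rho2 sigma2 q2 : R -> R).

(** The reflection changes the sign of the derivative, so the flux on the right
    side becomes [- sigma2 (- x) * v' (- x)]. *)
Lemma SL_eigenvalue_coupled (nu : R) :
  {within `[-1, 0], continuous sigma1} -> {within `[0, 1], continuous sigma2} ->
  (forall x, -1 <= x <= 0 -> 0 < sigma1 x) ->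
  (forall x, 0 <= x <= 1 -> 0 < sigma2 x) ->
  SL_eigenvalue M rho1 sigma1 q1 rho2 sigma2 q2 nu ->
  exists f1 p1 f2 p2, nontrivial f1 f2 /\
    coupled_state M rho1 (fun x => (sigma1 x)^-1) q1
      (fun x => rho2 (- x)) (fun x => (sigma2 (- x))^-1) (fun x => q2 (- x))
      nu f1 p1 f2 p2.
Proof.
move=> cs1 cs2 s1 s2 [u [v [[u' [v' [[uC vC] uE vE [u0 v0 uv] jump]]] nt]]].
exists u, (fun x => sigma1 x * u' x), (fun x => v (- x)),
  (fun x => - (sigma2 (- x) * v' (- x))); split.
  case: nt => -[x]; rewrite inE/= in_itv/= => /andP[x1 x2] nx.
    by exists x; [rewrite x1|left].
  by exists (- x); [rewrite lerN2 x2 oppr_le0|rewrite opprK; right].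
have N10 : -1 < (0 : R) by rewrite ltrN10.
have [vs ps] := SL_state ltr01 cs2 s2 vC vE.
have /(antiderivative_on_opp ltr01) := vs.
have /(antiderivative_on_opp ltr01) := ps.
rewrite oppr0 => ps' vs'.
split.
- exact: SL_state N10 cs1 s1 uC uE.
- split; first by move/antiderivative_on_eq: vs'; apply => // x _; rewrite mulrN.
  move/antiderivative_onN/antiderivative_on_eq: ps'; apply => // x _.
  by rewrite opprK.
- by rewrite opprK v0 mulr0 oppr0.
- by rewrite oppr0.
Qed.

End Eigenvalue.

(* nu 0, nu 1, ... are the eigenvalues nu_1, nu_2, ... *)
Theorem theorem5p1 (R : realType) (M : R)
  (rho1 sigma1 q1 rho2 sigma2 q2 : R -> R) (nu : nat -> R)
  (M_gt0 : 0 < M)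
  (rho1_H2 : H2 (-1) 0 rho1) (sigma1_H2 : H2 (-1) 0 sigma1)
  (q1_cont : {within `[-1, 0], continuous q1})
  (rho2_H2 : H2 0 1 rho2) (sigma2_H2 : H2 0 1 sigma2)
  (q2_cont : {within `[0, 1], continuous q2})
  (rho1_pos : uniformly_positive (-1) 0 rho1)
  (sigma1_pos : uniformly_positive (-1) 0 sigma1)
  (q1_pos : uniformly_positive (-1) 0 q1)
  (rho2_pos : uniformly_positive 0 1 rho2)
  (sigma2_pos : uniformly_positive 0 1 sigma2)
  (q2_pos : uniformly_positive 0 1 q2)
  (nu0_gt0 : 0 < nu 0%N)
  (nu_incr : forall n : nat, nu n < nu n.+1)
  (nu_eigenvalues : forall l : R,
     SL_eigenvalue M rho1 sigma1 q1 rho2 sigma2 q2 l <->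
     exists n : nat, l = nu n) :
  exists2 delta2 : R, 0 < delta2 & forall n : nat, delta2 <= nu n.+1 - nu n.
Proof.
have up a b (f : R -> R) : uniformly_positive a b f ->
    exists2 c, 0 < c & forall x, a <= x <= b -> c <= f x.
  by move=> [c c0 fc]; exists c => // x xab; apply: fc; rewrite inE/= in_itv.
have [cr1 cr10 r1P] := up _ _ _ rho1_pos.
have [cs1 cs10 s1P] := up _ _ _ sigma1_pos.
have [cq1 cq10 q1P] := up _ _ _ q1_pos.
have [cr2 cr20 r2P] := up _ _ _ rho2_pos.
have [cs2 cs20 s2P] := up _ _ _ sigma2_pos.
have [cq2 cq20 q2P] := up _ _ _ q2_pos.
have N10 : -1 < (0 : R) by rewrite ltrN10.
have [Ar1 r1E r1B] := H2_derivable_bounded N10 rho1_H2.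
have [As1 s1E s1B] := H2_derivable_bounded N10 sigma1_H2.
have [Ar2 r2E r2B] := H2_derivable_bounded ltr01 rho2_H2.
have [As2 s2E s2B] := H2_derivable_bounded ltr01 sigma2_H2.
have oppI (x : R) : -1 <= x <= 0 -> 0 <= - x <= 1.
  by move=> /andP[x1 x0]; rewrite oppr_ge0 x0 lerNl.
have oppo (x : R) : -1 < x < 0 -> 0 < - x < 1.
  by move=> /andP[x1 x0]; rewrite oppr_gt0 x0 ltrNl.
have [m1 [L1 [dtau1 [m10 w1]]]] : exists m L dtau, 0 < m /\
    weights_bounded m L rho1 rho1^`()%classic (fun x => (sigma1 x)^-1) dtau q1.
  apply: (weights_bounded_exist (A := Num.max Ar1 As1) (c := Num.min cr1 cs1)
    r1E s1E q1_cont) => [|x xI|x xI].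
  - by rewrite lt_min cr10.
  - split; [rewrite ge_min r1P//|rewrite ge_min s1P ?orbT//|].
    by apply: le_trans (q1P _ xI); exact: ltW.
  - by rewrite !le_max r1B// s1B// orbT.
have [m2 [L2 [dtau2 [m20 w2]]]] : exists m L dtau, 0 < m /\
    weights_bounded m L (fun x => rho2 (- x))
      (fun x => - rho2^`()%classic (- x)) (fun x => (sigma2 (- x))^-1) dtau
      (fun x => q2 (- x)).
  have r2E' := antiderivative_on_opp ltr01 r2E.
  have s2E' := antiderivative_on_opp ltr01 s2E.
  have q2c := continuous_within_opp ltr01 q2_cont.
  rewrite oppr0 in r2E' s2E' q2c.
  apply: (weights_bounded_exist (A := Num.max Ar2 As2) (c := Num.min cr2 cs2)
    r2E' s2E' q2c) => [|x /oppI xI|x /oppo xI].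
  - by rewrite lt_min cr20.
  - split; [rewrite ge_min r2P//|rewrite ge_min s2P ?orbT//|].
    by apply: le_trans (q2P _ xI); exact: ltW.
  - by rewrite !normrN !le_max r2B// s2B// orbT.
have [d0 d00 gap] := coupled_gap M_gt0 nu0_gt0 m10 m20 w1 w2.
have eigen n : exists f1 p1 f2 p2, nontrivial f1 f2 /\
    coupled_state M rho1 (fun x => (sigma1 x)^-1) q1
      (fun x => rho2 (- x)) (fun x => (sigma2 (- x))^-1) (fun x => q2 (- x))
      (nu n) f1 p1 f2 p2.
  have [cont1 _] := sigma1_H2; have [cont2 _] := sigma2_H2.
  apply: SL_eigenvalue_coupled => //.
  - by move=> x xI; exact: lt_le_trans (s1P _ xI).
  - by move=> x xI; exact: lt_le_trans (s2P _ xI).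
  - by apply/nu_eigenvalues; exists n.
have nu_ge n : nu 0%N <= nu n.
  by elim: n => // n /le_trans; apply; exact: ltW.
exists d0 => // n; rewrite leNgt; apply/negP => small.
have [f1 [p1 [f2 [p2 [fn fs]]]]] := eigen n.
have [g1 [r1 [g2 [r2 [gn gs]]]]] := eigen n.+1.
apply: (gap (nu n) (nu n.+1 - nu n) f1 p1 f2 p2 g1 r1 g2 r2) => //.
- by rewrite subr_gt0.
- exact: ltW.
- by rewrite addrC subrK.
Qed.
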